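(* Let $W_2^3[a,T]$, $W_2^1[a,T]$, $L$, $F$, the sequence $\{x_i\}_{i=1}^\infty$ of pairwise distinct points of $[a,T]$, the orthonormal functions $\bar\psi_i$ and the orthogonalization coefficients $\beta_{ik}$ be as defined in the context. Define recursively $u_0=0$ and, for $n\ge1$, $$A_n=\sum_{k=1}^{n}\beta_{nk}\,F(x_k,u_{k-1}(x_k)),\qquad u_n(x)=\sum_{i=1}^{n}A_i\,\bar\psi_i(x).$$ If the sequence $\|u_n\|_{W_2^3}$ is bounded and $\{x_i\}_{i=1}^\infty$ is dense in $[a,T]$, then $u_n$ converges in $W_2^3[a,T]$ to the exact solution $u\in W_2^3[a,T]$ of $$Lu(x)=F(x,u(x)),\quad a<x<T,\qquad u(a)=0,\ u'(a)=0,$$ and $u(x)=\sum_{i=1}^{\infty}A_i\,\bar\psi_i(x)$.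
   Context: Let $a<T$ and $k$ be real constants. $W_2^3[a,T]$ is the space of real functions $u$ on $[a,T]$ such that $u''$ exists and is absolutely continuous on $[a,T]$, $u'''\in L^2[a,T]$, and $u(a)=u'(a)=0$, with inner product $\langle u,v\rangle_{W_2^3}=\sum_{i=0}^{2}u^{(i)}(a)v^{(i)}(a)+\int_a^T u'''(s)v'''(s)\,ds$ and norm $\|u\|_{W_2^3}=\sqrt{\langle u,u\rangle_{W_2^3}}$. It is a reproducing kernel Hilbert space. $W_2^1[a,T]$ is the space of absolutely continuous real functions $u$ on $[a,T]$ with $u'\in L^2[a,T]$, with inner product $\langle u,v\rangle_{W_2^1}=u(a)v(a)+\int_a^T u'(t)v'(t)\,dt$. It is a reproducing kernel Hilbert space; its reproducing kernel is denoted $G_x(y)$. $L:W_2^3[a,T]\to W_2^1[a,T]$ is the operator $Lu(x)=u''(x)+\frac{k}{x}u'(x)$ (at $x=0$, if $0\in[a,T]$, the value is understood by continuity). It is a standing assumption that $L$ is a well-defined bounded linear operator between these spaces and that it is injective. The function $F:[a,T]\times\mathbb{R}\to\mathbb{R}$ is analytic (in particular continuous), with $x\mapsto F(x,y(x))$ in $W_2^1[a,T]$ whenever $y\in W_2^3[a,T]$, and such that the initial value problem $Lu(x)=F(x,u(x))$ for $a<x<T$, $u(a)=u'(a)=0$, has a unique solution $u\in W_2^3[a,T]$, this solution being analytic. Given a sequence $\{x_i\}_{i=1}^\infty$ of pairwise distinct points of $[a,T]$, put $\varphi_i=G_{x_i}$ and $\psi_i=L^*\varphi_i\in W_2^3[a,T]$,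 where $L^*$ is the adjoint of $L$; equivalently $\langle u,\psi_i\rangle_{W_2^3}=Lu(x_i)$ for all $u\in W_2^3[a,T]$. The orthonormal system $\{\bar\psi_i\}_{i=1}^\infty$ is obtained from $\{\psi_i\}_{i=1}^\infty$ by Gram-Schmidt orthonormalization in $W_2^3[a,T]$: $\bar\psi_i=\sum_{k=1}^{i}\beta_{ik}\psi_k$ with $\beta_{ii}>0$. *)

(* Defs.v *)
From HB Require Import structures.
From mathcomp Require Import all_boot all_order all_algebra.
From mathcomp Require Import all_classical all_reals all_analysis.

Set Implicit Arguments.
Unset Strict Implicit.
Unset Printing Implicit Defensive.

Import Order.TTheory GRing.Theory Num.Theory.
Import numFieldNormedType.Exports.

Local Open Scope classical_set_scope.
Local Open Scope ring_scope.

(* Functions on [a, T] are represented by total functions R -> R.  Every notion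
   below depends only on their values on [a, T], and two such functions are
   identified when they agree on [a, T]. *)

(* Derivatives are taken relative to a set D, so that they are one-sided at
   the endpoints when D = [a, T].  [derive_in D u x] is meaningful only
   where [derivable_in D u x] holds. *)
Definition diff_quotient (R : realType) (u : R -> R) (x y : R) : R :=
  (u y - u x) / (y - x).

Definition derivable_in (R : realType) (D : set R) (u : R -> R) (x : R) :
    Prop :=
  cvg (diff_quotient u x @ within D x^').

Definition derive_in (R : realType) (D : set R) (u : R -> R) (x : R) : R :=
  lim (diff_quotient u x @ within D x^').

Definition abs_continuous (R : realType) (a T : R) (u : R -> R) : Prop :=
  forall e : R, 0 < e -> exists2 d : R, 0 < d &
    forall (n : nat) (s t : 'I_n -> R),
      (forall i, a <= s i /\ s i <= t i /\ t i <= T) ->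
      (forall i j, i != j ->
        [set` `]s i, t i[] `&` [set` `]s j, t j[] = set0) ->
      \sum_(i < n) (t i - s i) < d ->
      \sum_(i < n) `|u (t i) - u (s i)| < e.

Definition in_L2 (R : realType) (D : set R) (g : R -> R) : Prop :=
  measurable_fun D g /\
  (\int[lebesgue_measure]_(x in D) ((g x) ^+ 2)%:E < +oo)%E.

(* "u' in L^2" means that u' exists almost everywhere and is square integrable;
   the first part already follows from absolute continuity. *)
Definition W21 (R : realType) (a T : R) : set (R -> R) := [set u |
  [/\ abs_continuous a T u,
      {ae lebesgue_measure, forall x, x \in `[a, T] ->
        derivable_in `[a, T] u x} &
      in_L2 `[a, T] (derive_in `[a, T] u)] ].

Definition W21_ip (R : realType) (a T : R) (u v : R -> R) : R :=
  u a * v a +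
  Rintegral lebesgue_measure `[a, T]
    (fun t => derive_in `[a, T] u t * derive_in `[a, T] v t).

Definition W21_norm (R : realType) (a T : R) (u : R -> R) : R :=
  Num.sqrt (W21_ip a T u u).

Definition nderive_in (R : realType) (D : set R) (n : nat) (u : R -> R) :
    R -> R :=
  iter n (derive_in D) u.

(* The third condition says that u'' is absolutely continuous and that u''' is
   in L^2. *)
Definition W23 (R : realType) (a T : R) : set (R -> R) := [set u |
  [/\ forall x, x \in `[a, T] -> derivable_in `[a, T] u x,
      forall x, x \in `[a, T] -> derivable_in `[a, T] (derive_in `[a, T] u) x,
      W21 a T (nderive_in `[a, T] 2 u),
      u a = 0 & derive_in `[a, T] u a = 0] ].

Definition W23_ip (R : realType) (a T : R) (u v : R -> R) : R :=
  \sum_(i < 3) nderive_in `[a, T] i u a * nderive_in `[a, T] i v a +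
  Rintegral lebesgue_measure `[a, T]
    (fun s => nderive_in `[a, T] 3 u s * nderive_in `[a, T] 3 v s).

Definition W23_norm (R : realType) (a T : R) (u : R -> R) : R :=
  Num.sqrt (W23_ip a T u u).

(* Lu(x) = u''(x) + (k / x) u'(x), extended by continuity at x = 0. *)
Definition Lop (R : realType) (a T k : R) (u : R -> R) (x : R) : R :=
  let f (y : R) :=
    nderive_in `[a, T] 2 u y + k / y * derive_in `[a, T] u y in
  if x == 0 then lim (f y @[y --> within `[a, T] (0 : R)^']) else f x.

Definition L_bounded_linear (R : realType) (a T k : R) : Prop :=
  [/\ forall u, W23 a T u -> W21 a T (Lop a T k u),
      forall (c : R) u v, W23 a T u -> W23 a T v ->
        forall x, x \in `[a, T] ->
          Lop a T k (fun y => c * u y + v y) x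
          = c * Lop a T k u x + Lop a T k v x &
      exists C : R, forall u, W23 a T u ->
        W21_norm a T (Lop a T k u) <= C * W23_norm a T u].

Definition L_injective (R : realType) (a T k : R) : Prop :=
  forall u v, W23 a T u -> W23 a T v ->
    (forall x, x \in `[a, T] -> Lop a T k u x = Lop a T k v x) ->
    forall x, x \in `[a, T] -> u x = v x.

Definition is_kernel_W21 (R : realType) (a T : R) (G : R -> R -> R) : Prop :=
  forall x, x \in `[a, T] ->
    W21 a T (G x) /\ forall u, W21 a T u -> W21_ip a T u (G x) = u x.

Definition is_adjoint_L (R : realType) (a T k : R)
    (Lstar : (R -> R) -> (R -> R)) : Prop :=
  forall v, W21 a T v ->
    W23 a T (Lstar v) /\
    forall u, W23 a T u -> W21_ip a T (Lop a T k u) v = W23_ip a T u (Lstar v).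

(* Real-analyticity on a possibly non-open set D: near each point of D the
   function is the sum of a convergent power series, relatively to D. *)
Definition analytic_on (R : realType) (D : set R) (u : R -> R) : Prop :=
  forall x0, D x0 -> exists (r : R) (c : nat -> R), 0 < r /\
    forall x, D x -> `|x - x0| < r ->
      series (fun i => c i * (x - x0) ^+ i) @ \oo --> u x.

(* Same notion on D x R; the double power series is absolutely convergent, so
   its sum may be computed along square partial sums. *)
Definition analytic2_on (R : realType) (D : set R) (F : R -> R -> R) : Prop :=
  forall x0 y0, D x0 -> exists (r : R) (c : nat -> nat -> R), 0 < r /\
    forall x y, D x -> `|x - x0| < r -> `|y - y0| < r ->
      let term i j := c i j * (x - x0) ^+ i * (y - y0) ^+ j in
      cvgn (fun n => \sum_(i < n) \sum_(j < n) `|term i j|) /\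
      (fun n => \sum_(i < n) \sum_(j < n) term i j) @ \oo --> F x y.

Definition ivp_solution (R : realType) (a T k : R) (F : R -> R -> R)
    (u : R -> R) : Prop :=
  [/\ W23 a T u,
      forall x, x \in `]a, T[ -> Lop a T k u x = F x (u x),
      u a = 0 & derive_in `[a, T] u a = 0].

(* Sequences are indexed from 0: index i stands for the usual index i + 1. *)
Definition psi_bar (R : realType) (beta : nat -> nat -> R)
    (psi : nat -> R -> R) (i : nat) : R -> R :=
  fun y => \sum_(j < i.+1) beta i j * psi j y.

(* Gram-Schmidt orthonormalization: the coefficients form the unique lower
   triangular array with positive diagonal that makes psi_bar orthonormal. *)
Definition gram_schmidt (R : realType) (a T : R) (psi : nat -> R -> R)
    (beta : nat -> nat -> R) : Prop :=
  (forall i, 0 < beta i i) /\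
  (forall i j,
     W23_ip a T (psi_bar beta psi i) (psi_bar beta psi j) = (i == j)%:R).

(* u_n = A_1 psi_bar_1 + ... + A_n psi_bar_n; in particular u_0 = 0. *)
Definition approx_sol (R : realType) (A : nat -> R) (phi : nat -> R -> R)
    (n : nat) : R -> R :=
  fun y => \sum_(i < n) A i * phi i y.

(* Main.v *)
Require Import Defs.
From HB Require Import structures.
From mathcomp Require Import all_boot all_order all_algebra.
From mathcomp Require Import all_classical all_reals all_analysis.
From mathcomp Require Import measurable_realfun ring lra.

(** By orthonormality and boundedness of [u_n], the series of the [A_i ^+ 2]
    converges, so [u_n] is Cauchy and has a limit [g] by completeness of W23.
    Testing [g] against the triangular system [psi_bar] gives
    [L g (x_j) = F (x_j, u_j (x_j))] for all [j].  Letting the [x_j] accumulate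
    at an arbitrary point, continuity of [F] and of [L g] together with the
    uniform convergence [u_n -> g] gives [L g = F (x, g)], hence [g = u] by
    uniqueness.

    Completeness of W21 comes from the Riesz-Fischer theorem and Lebesgue's
    differentiation theorem.  Uniform convergence needs a bound, uniform in
    [y], on the norm of the kernel functions [G y].  That bound follows from the
    reproducing property alone, without integrating absolutely continuous
    functions.  *)

Set Implicit Arguments.
Unset Strict Implicit.
Unset Printing Implicit Defensive.

Import Order.TTheory GRing.Theory Num.Theory.
Import numFieldNormedType.Exports.

Local Open Scope classical_set_scope.
Local Open Scope ring_scope.

(** * Derivatives relative to a segment *)

Section RelativeDerivative.
Variables (R : realType) (a T : R).
Hypothesis aT : a < T.
Local Notation D := [set` `[a, T]].
Implicit Types (u v : R -> R) (x y c l : R).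

(** Two maps reduce the analysis to L2. Because [u] and its first derivative vanish at [a], taking
    the second derivative is an isometry of W23 onto W21, up to equality on the segment. On W21, the
    pair formed by the value at [a] and the derivative carries the inner product to that of R x L2.
    Completeness is pulled back along both maps by taking primitives of limits. Derivatives in W21
    exist only almost everywhere and [derive_in] takes default values elsewhere, so its
    measurability is a problem of its own. It is solved by showing that the set of points of
    differentiability of a continuous function is Borel. In the final limit, node and iterate carry
    the same index: L g (x_n) = F (x_n, u_n (x_n)). A node near a given point helps only if its
    index is also large, so density is needed for every tail of the sequence of nodes. *)

Lemma itv_near x e : x \in `[a, T] -> 0 < e ->
  exists y, [/\ y \in `[a, T], y != x & `|y - x| < e].
Proof.
rewrite in_itv/= => /andP[ax xT] e0.
(* Since [2 * m <= T - a], at least one of [x + m] and [x - m] stays in the segment. *)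
have [m [m0 me mT]] : exists m, [/\ 0 < m, m < e & 2 * m <= T - a].
  exists (Num.min (e / 2) ((T - a) / 2)); split.
  - by rewrite lt_min !divr_gt0// subr_gt0.
  - by rewrite gt_min; apply/orP; left; lra.
  - rewrite -ler_pdivlMl//; by rewrite ge_min [_^-1 * _]mulrC lexx orbT.
have [xT'|Tx] := leP (x + m) T.
  exists (x + m); split; first by rewrite in_itv/=; apply/andP; split; lra.
  - by rewrite -subr_eq0 addrC addKr gt_eqF.
  - by rewrite addrC addKr gtr0_norm.
exists (x - m); split; first by rewrite in_itv/=; apply/andP; split; lra.
- by rewrite -subr_eq0 addrC addKr oppr_eq0 gt_eqF.
- by rewrite addrC addKr normrN gtr0_norm.
Qed.

(** No point of a nondegenerate segment is isolated in it, which makes relative limits, hence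
    relative derivatives, unique. *)
Lemma within_itv_proper x : x \in `[a, T] -> ProperFilter (within D x^').
Proof.
move=> xD; split; last exact: within_filter.
rewrite /within/= => -/nbhs_ballP[e /= e0 be].
have [y [yD yx yxe]] := itv_near xD e0.
by apply: (be y) => //; rewrite /ball/= distrC.
Qed.

Lemma cvg_diff_quotientP u x l :
  (diff_quotient u x @ within D x^' --> l) <->
  forall e, 0 < e -> exists2 d, 0 < d & forall y, y \in `[a, T] -> y != x ->
    `|y - x| < d -> `|diff_quotient u x y - l| < e.
Proof.
split=> [/cvgrPdist_lt H e e0|H].
  have := H _ e0; rewrite /within/= => -/nbhs_ballP[d /= d0 bd].
  exists d => // y yD yx yxd; rewrite distrC; apply: bd => //.
  by rewrite /ball/= distrC.
apply/cvgrPdist_lt => e e0; have [d d0 dP] := H e e0.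
apply/nbhs_ballP; exists d => //= y; rewrite /ball/= => xyd yx yD.
by rewrite distrC dP// distrC.
Qed.

Lemma derive_inE u x l : x \in `[a, T] ->
  diff_quotient u x @ within D x^' --> l ->
  derivable_in D u x /\ derive_in D u x = l.
Proof.
move=> /within_itv_proper PF H; split; first exact: (cvgP _ H).
exact: (cvg_lim _ H).
Qed.

Lemma derive_in_linear c u v x : x \in `[a, T] ->
  derivable_in D u x -> derivable_in D v x ->
  derivable_in D (fun t => c * u t + v t) x /\
  derive_in D (fun t => c * u t + v t) x = c * derive_in D u x + derive_in D v x.
Proof.
move=> xD ux vx; apply: derive_inE => //.
have -> : diff_quotient (fun t => c * u t + v t) x =
    (fun y => c * diff_quotient u x y + diff_quotient v x y).
  by apply/funext => y; rewrite /diff_quotient mulrA -mulrDl; congr (_ / _); ring.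
have PF := within_itv_proper xD.
apply: (@cvgD _ _ _ (within D x^') _ (fun y => c * diff_quotient u x y)
  (diff_quotient v x)) => //.
exact: (@cvgMl_tmp _ _ (within D x^') _ (diff_quotient u x)).
Qed.

Lemma eq_diff_quotient u v x : x \in `[a, T] -> {in `[a, T], u =1 v} ->
  diff_quotient u x @ within D x^' = diff_quotient v x @ within D x^'.
Proof.
move=> xD uv; apply/seteqP; split=> A /=; rewrite !nbhs_filterE /fmap/= /within/=;
  apply: (@filterS _ (x^') _) => y yA yD;
  by have := yA yD; rewrite /diff_quotient !uv.
Qed.

Lemma eq_derive_in u v x : x \in `[a, T] -> {in `[a, T], u =1 v} ->
  derive_in D u x = derive_in D v x.
Proof. by move=> xD uv; rewrite /derive_in (eq_diff_quotient xD uv). Qed.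

Lemma eq_derivable_in u v x : x \in `[a, T] -> {in `[a, T], u =1 v} ->
  derivable_in D u x -> derivable_in D v x.
Proof. by move=> xD uv; rewrite /derivable_in (eq_diff_quotient xD uv). Qed.

Lemma eq_nderive_in n u v x : x \in `[a, T] -> {in `[a, T], u =1 v} ->
  nderive_in D n u x = nderive_in D n v x.
Proof.
move=> xD uv; elim: n x xD => [|n IH] x xD; first exact: uv.
by apply: eq_derive_in => //; exact: IH.
Qed.

Lemma derivable_derive_in u x : x \in `[a, T] -> derivable u x 1 ->
  derivable_in D u x /\ derive_in D u x = derive1 u x.
Proof.
move=> xD dux; apply: derive_inE => //; rewrite derive1E.
apply/cvg_diff_quotientP => e e0.
move/cvgrPdist_lt : dux => /(_ _ e0).
move=> /nbhs_ballP[d /= d0 bd]; exists d => // y yD yx yxd.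
rewrite distrC; have := bd (y - x); rewrite /ball/= sub0r normrN => /(_ yxd).
rewrite subr_eq0 => /(_ yx).
by rewrite /diff_quotient [_%:A]mulr1 subrK [_ *: _]mulrC.
Qed.

Definition rel_continuous u := forall x, x \in `[a, T] -> forall e, 0 < e ->
  exists2 d, 0 < d & forall y, y \in `[a, T] -> `|y - x| < d -> `|u y - u x| < e.

Lemma rel_continuousP u : rel_continuous u <-> {within D, continuous u}.
Proof.
split=> [H|/subspace_continuousP H x xD e e0].
  apply/subspace_continuousP => x xD.
  apply/cvgrPdist_lt => e e0; have [d d0 dP] := H x xD e e0.
  apply/nbhs_ballP; exists d => //= y; rewrite /ball/= => xyd yD.
  by rewrite distrC dP// distrC.
have := H x xD => /cvgrPdist_lt/(_ e e0).
move=> /nbhs_ballP[d /= d0 dP]; exists d => // y yD yxd.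
by rewrite distrC; apply: dP => //; rewrite /ball/= distrC.
Qed.

Lemma derivable_in_rel_continuous u x : x \in `[a, T] -> derivable_in D u x ->
  forall e, 0 < e ->
  exists2 d, 0 < d & forall y, y \in `[a, T] -> `|y - x| < d -> `|u y - u x| < e.
Proof.
move=> xD /cvg_diff_quotientP H e e0.
have [d d0 dP] := H 1 ltr01.
set l := lim _ in dP.
have l0 : 0 < `|l| + 1 by rewrite ltr_wpDl.
(* Within [d] the difference quotient is at distance less than 1 from [l], so [u] is Lipschitz at
   [x] with constant [|l| + 1]. *)
exists (Num.min d (e / (`|l| + 1))); first by rewrite lt_min d0 divr_gt0.
move=> y yD; rewrite lt_min => /andP[yd ye].
have [->|yx] := eqVneq y x; first by rewrite subrr normr0.
have := dP y yD yx yd; rewrite /diff_quotient => q1.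
have yx0 : y - x != 0 by rewrite subr_eq0.
rewrite -[X in `|X|](divfK yx0) normrM.
move: ye; rewrite ltr_pdivlMr// => ye; apply: le_lt_trans ye.
rewrite mulrC ler_wpM2l// -(subrK l ((u y - u x) / (y - x))).
by rewrite (le_trans (ler_normD _ _))// addrC lerD2l ltW.
Qed.

Lemma abs_continuous_rel_continuous u : abs_continuous a T u -> rel_continuous u.
Proof.
move=> H x; rewrite in_itv/= => /andP[ax xT] e e0; have [d d0 dP] := H e e0.
exists d => // y; rewrite in_itv/= => /andP[ay yT] yxd.
(* A family of one interval, with endpoints sorted because [y] may lie on either side of [x]. *)
have := dP 1%N (fun=> Num.min x y) (fun=> Num.max x y).
rewrite !big_ord1; have [xy|yx] := leP x y.
  apply => //; last by rewrite -(ger0_norm (x := y - x))// subr_ge0.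
  by move=> i j; rewrite !ord1 eqxx.
rewrite distrC; apply => //; first by move=> _; split => //; split => //; exact: ltW.
  by move=> i j; rewrite !ord1 eqxx.
by rewrite -(gtr0_norm (x := x - y)) ?subr_gt0// distrC.
Qed.

Lemma abs_continuous_linear c u v : abs_continuous a T u -> abs_continuous a T v ->
  abs_continuous a T (fun x => c * u x + v x).
Proof.
move=> Hu Hv e e0.
have c0 : 0 < `|c| + 1 by rewrite ltr_wpDl.
have [d1 d10 P1] := Hu (e / 2 / (`|c| + 1)) ltac:(by rewrite !divr_gt0).
have [d2 d20 P2] := Hv (e / 2) ltac:(by rewrite divr_gt0).
exists (Num.min d1 d2); first by rewrite lt_min d10.
move=> n s t st dis; rewrite lt_min => /andP[l1 l2].
have := P1 n s t st dis l1; rewrite ltr_pdivlMr// mulrC => {}P1.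
have {}P2 := P2 n s t st dis l2.
rewrite (splitr e); apply: le_lt_trans (ltrD P1 P2).
rewrite mulr_sumr -big_split/=; apply: ler_sum => i _.
rewrite (_ : _ - _ = c * (u (t i) - u (s i)) + (v (t i) - v (s i))); last by ring.
rewrite (le_trans (ler_normD _ _))// lerD2r normrM ler_wpM2r//.
by rewrite lerDl.
Qed.

Lemma abs_continuous_ext u v : {in `[a, T], u =1 v} ->
  abs_continuous a T u -> abs_continuous a T v.
Proof.
move=> uv Hu e e0; have [d d0 P] := Hu e e0; exists d => // n s t st dis l.
apply: le_lt_trans (P n s t st dis l); apply: ler_sum => i _.
have [asi [ssi tsi]] := st i.
by rewrite !uv// in_itv/= ?tsi ?andbT ?asi ?(le_trans asi) ?(le_trans ssi).
Qed.

End RelativeDerivative.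

(** * Measurability of the relative derivative *)

Section MeasurableDerivative.
Variables (R : realType) (a T : R).
Hypothesis aT : a < T.
Local Notation D := [set` `[a, T]].
Variable u : R -> R.
Hypothesis cu : rel_continuous a T u.

(** Points where the difference quotients oscillate by at most [e] at scale [d]. The inequality on
    the oscillation is weak so that, for continuous [u], these sets are closed. *)
Definition osc_set (e d : R) : set R := [set x | x \in `[a, T] /\
  forall y z, y \in `[a, T] -> z \in `[a, T] -> y != x -> z != x ->
    `|y - x| < d -> `|z - x| < d ->
    `|diff_quotient u x y - diff_quotient u x z| <= e].

(** For fixed [y] and [z], the difference quotients depend continuously on the base point as long as
    it avoids [y] and [z], so the weak inequality passes to the limit. *)
Lemma closure_osc_set e d (x : R) : closure (osc_set e d) x -> osc_set e d x.
Proof.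
move=> clx.
have xD : x \in `[a, T].
  have : closed D by exact: itv_closed.
  by apply; apply: closure_subset clx => y [].
split=> // y z yD zD yx zx yd zd.
have PF : ProperFilter (within (osc_set e d) (nbhs x)) by exact: within_nbhs_proper.
have idx : w @[w --> within (osc_set e d) (nbhs x)] --> x.
  exact: cvg_within.
have ux : u w @[w --> within (osc_set e d) (nbhs x)] --> u x.
  apply/cvgrPdist_lt => r r0; have [s s0 sP] := cu xD r0.
  apply/nbhs_ballP; exists s => //= w; rewrite /ball/= => xw [wD _].
  by rewrite distrC sP// distrC.
have qx v : v != x ->
    diff_quotient u w v @[w --> within (osc_set e d) (nbhs x)] --> diff_quotient u x v.
  move=> vx; rewrite /diff_quotient.
  have h1 : v - w @[w --> within (osc_set e d) (nbhs x)] --> v - x.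
    by apply: cvgB => //; exact: cvg_cst.
  have h2 : u v - u w @[w --> within (osc_set e d) (nbhs x)] --> u v - u x.
    by apply: cvgB => //; exact: cvg_cst.
  by apply: (cvgM h2); apply: cvgV h1; rewrite subr_eq0.
have qyz : diff_quotient u w y - diff_quotient u w z @[w -->
    within (osc_set e d) (nbhs x)] --> diff_quotient u x y - diff_quotient u x z.
  by apply: cvgB; exact: qx.
apply: (cvgr_to_le (cvg_norm qyz)).
(* The constraints on [y] and [z] are open conditions on the base point, hence persist near [x]. *)
have near_ne v : v != x -> `|v - x| < d ->
    exists2 r, 0 < r & forall w, `|x - w| < r -> v != w /\ `|v - w| < d.
  move=> vx vd; exists (Num.min `|v - x| (d - `|v - x|)).
    by rewrite lt_min normr_gt0 !subr_gt0 subr_eq0 vx.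
  move=> w; rewrite lt_min => /andP[w1 w2]; split.
    by apply: contraTneq w1 => <-; rewrite distrC ltxx.
  rewrite (_ : v - w = (v - x) + (x - w)); last by ring.
  by rewrite (le_lt_trans (ler_normD _ _))// addrC -ltrBrDr.
have [r r0 rP] := near_ne _ yx yd.
have [r' r'0 r'P] := near_ne _ zx zd.
apply/nbhs_ballP; exists (Num.min r r') => /=; first by rewrite lt_min r0.
move=> w; rewrite /ball/= lt_min => /andP[/rP[yw ywd] /r'P[zw zwd]] [_ Ew].
exact: Ew.
Qed.

Lemma closed_osc_set e d : closed (osc_set e d).
Proof. by move=> x; exact: closure_osc_set. Qed.

(** Cauchy's criterion, with tolerances and radii restricted to inverses of positive integers so
    that only countable unions and intersections occur. *)
Lemma derivable_in_osc x : x \in `[a, T] ->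
  derivable_in D u x <->
  forall m : nat, exists n : nat, osc_set m.+1%:R^-1 n.+1%:R^-1 x.
Proof.
move=> xD; have PF := within_itv_proper aT xD; split=> [|H].
  move=> /cvg_diff_quotientP H m.
  have [d d0 dP] := H (m.+1%:R^-1 / 2) ltac:(by rewrite divr_gt0).
  have [n nd] : exists n : nat, n.+1%:R^-1 < d.
    by exists (Num.truncn d^-1); rewrite invf_plt ?posrE// truncnS_gt.
  exists n; split=> // y z yD zD yx zx yd zd.
  set l := lim _ in dP.
  rewrite (_ : _ - _ = (diff_quotient u x y - l) - (diff_quotient u x z - l)); last by ring.
  rewrite (le_trans (ler_normB _ _))// [leRHS]splitr lerD// ltW// dP//.
    exact: lt_trans nd.
  exact: lt_trans nd.
apply: cauchy_cvg; apply: cauchy_exP => e e0.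
have [m me] : exists m : nat, m.+1%:R^-1 < e.
  by exists (Num.truncn e^-1); rewrite invf_plt ?posrE// truncnS_gt.
have [n [_ nP]] := H m.
have [y [yD yx yd]] : exists y, [/\ y \in `[a, T], y != x & `|y - x| < n.+1%:R^-1].
  by apply: itv_near => //; rewrite invr_gt0.
exists (diff_quotient u x y).
apply/nbhs_ballP; exists n.+1%:R^-1 => /=; first by rewrite invr_gt0.
move=> z; rewrite /ball/= => xz zx zD.
by apply: le_lt_trans me; apply: nP => //; rewrite distrC.
Qed.

Lemma measurable_derive_in : measurable_fun D (derive_in D u).
Proof.
pose C := D `&` [set x | derivable_in D u x].
have mD : measurable D by [].
have mC : measurable C.
  rewrite (_ : C = D `&` \bigcap_(m in setT) \bigcup_(n in setT) osc_set m.+1%:R^-1 n.+1%:R^-1).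
    apply: measurableI => //; apply: bigcap_measurableType => m _.
    by apply: bigcup_measurable => n _; apply: closed_measurable; exact: closed_osc_set.
  apply/seteqP; split=> x /= [xD].
    move=> /(derivable_in_osc xD) H; split => // m _.
    by have [n nP] := H m; exists n.
  move=> H; split=> //; apply/derivable_in_osc => // m.
  by have [n _ nP] := H m I; exists n.
(* Three pieces: no derivative, derivative at a point other than [T], and the point [T], where the
   forward quotients used below degenerate. *)
have DE : D = (D `\` C) `|` ((C `\` [set T]) `|` [set T]).
  apply/seteqP; split=> x.
    move=> xD; have [->|xT] := eqVneq x T; first by right; right.
    have [xC|nC] := pselect (C x); last by left.
    by right; left; split => //; exact/eqP.
  by move=> [[]//|[[[]]//|->]]; rewrite /= in_itv/= lexx ltW.
rewrite [X in measurable_fun X _]DE.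
apply/measurable_funU; [exact: measurableD|by apply: measurableU => //; apply: measurableD|split].
  (* Where the quotients diverge, [lim] is the constant default [point]. *)
  apply: (@eq_measurable_fun _ _ _ _ _ (cst point)) => // x /set_mem[xD nC].
  rewrite /derive_in dvgP//.
  by move=> dx; apply: nC; split.
apply/measurable_funU => //; [exact: measurableD|split; last exact: measurable_fun_set1].
(* A step proportional to [T - x] keeps [p n x] in the segment and depends measurably on [x]; the
   derivative is then a pointwise limit of measurable quotients. *)
pose p (n : nat) x := x + (T - x) / n.+2%:R.
have mu_ : measurable_fun D u.
  by apply: subspace_continuous_measurable_fun => //; exact: (rel_continuousP a T u).1 cu.
apply: (@measurable_fun_cvg _ _ _ _ (fun n x => (u (p n x) - u x) * (n.+2%:R * (T - x)^-1))).
  move=> n; apply: measurable_funM.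
    apply: measurable_funB; last by apply: measurable_funS mu_ => // x [[]].
    apply: (measurable_comp (F := D)) => //.
      move=> _ [x [[+ _] _] <-] /=; rewrite !in_itv/= => /andP[ax xT].
      have Tx : 0 <= T - x by rewrite subr_ge0.
      have h0 : 0 <= (T - x) / n.+2%:R by rewrite divr_ge0.
      have h1 : (T - x) / n.+2%:R <= T - x.
        by rewrite ler_pdivrMr// ler_peMr// ler1n.
      by rewrite /p ler_wpDr//= addrC -lerBrDr.
    apply: measurable_funTS; apply: continuous_measurable_fun => x.
    apply: cvgD; first exact: cvg_id.
    by apply: cvgM; [apply: cvgB; [exact: cvg_cst|exact: cvg_id]|exact: cvg_cst].
  apply: measurable_funM => //.
  have oT : open [set x : R | x != T] by exact: open_neq.
  apply: (@measurable_funS _ _ _ _ [set x : R | x != T]).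
  - exact: open_measurable.
  - by move=> x [_ /eqP].
  have cT (y : R) : y != T -> {for y, continuous (fun x => (T - x)^-1)}.
    move=> yT; have h : T - w @[w --> y] --> T - y.
      by apply: cvgB; [exact: cvg_cst|exact: cvg_id].
    by apply: cvgV h; rewrite subr_eq0 eq_sym.
  by apply: open_continuous_measurable_fun => // x /set_mem/=; exact: cT.
move=> x [[xD dx] /eqP/= xT].
have Tx : 0 < T - x.
  by move: xD; rewrite /= in_itv/= subr_gt0 lt_neqAle xT => /andP[_ ->].
apply/cvgrPdist_lt => e e0.
have /cvg_diff_quotientP/(_ e e0)[d d0 dP] := dx.
near=> n.
have pn0 : 0 < (T - x) / n.+2%:R by rewrite divr_gt0.
have px : p n x - x = (T - x) / n.+2%:R by rewrite /p addrC addKr.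
rewrite -invf_div -px distrC; apply: dP; last 2 first.
- by rewrite -subr_eq0 px gt_eqF.
- rewrite px gtr0_norm// ltr_pdivrMr// mulrC -ltr_pdivrMr//.
  apply: (@lt_le_trans _ _ n%:R); last by rewrite ler_nat -addn2 leq_addr.
  by near: n; exact: nbhs_infty_gtr.
move: xD; rewrite /p /= !in_itv/= => /andP[ax xT'].
have h1 : (T - x) / n.+2%:R <= T - x.
  by rewrite ler_pdivrMr// ler_peMr ?ler1n// ltW.
by rewrite ler_wpDr ?(ltW pn0)//= addrC -lerBrDr.
Unshelve. all: end_near. Qed.

End MeasurableDerivative.

(** * Square integrable functions *)

Section SquareIntegrable.
Variables (R : realType) (D : set R).
Local Notation mu := (@lebesgue_measure R).
Hypothesis mD : measurable (D : set (measurableTypeR R)).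
Implicit Types (f g h : R -> R).

Definition L2_ip f g := Rintegral mu D (fun t => f t * g t).

Lemma in_L2P f : in_L2 D f <->
  measurable_fun D f /\ mu.-integrable D (fun x => (f x ^+ 2)%:E).
Proof.
have E : (fun x => `|(f x ^+ 2)%:E|%E) = (fun x => (f x ^+ 2)%:E).
  by apply/funext => x; rewrite gee0_abs// lee_fin sqr_ge0.
split=> -[mf H]; split => //.
  apply/integrableP; split; last by rewrite E.
  by apply/measurable_EFinP; exact: measurable_funX.
by move/integrableP : H => -[_]; rewrite E.
Qed.

Lemma in_L2_integrableM f g : in_L2 D f -> in_L2 D g ->
  mu.-integrable D (EFin \o (fun x => f x * g x)).
Proof.
move=> /in_L2P[mf If] /in_L2P[mg Ig].
apply: (@le_integrable _ _ _ mu D mD _ (fun x => (f x ^+ 2)%:E + (g x ^+ 2)%:E)%E).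
- by apply/measurable_EFinP; exact: measurable_funM.
- move=> x _; rewrite -EFinD !abse_EFin lee_fin.
  rewrite [leRHS]ger0_norm ?addr_ge0 ?sqr_ge0//.
  by rewrite ler_norml; apply/andP; split; nra.
- exact: integrableD.
Qed.

Lemma in_L2_linear c f g : in_L2 D f -> in_L2 D g ->
  in_L2 D (fun x => c * f x + g x).
Proof.
move=> /[dup] /in_L2P[mf If] f2 /[dup] /in_L2P[mg Ig] g2.
have Ifg := in_L2_integrableM f2 g2.
apply/in_L2P; split; first by apply: measurable_funD => //; exact: measurable_funM.
apply: (@eq_integrable _ _ _ mu D mD (fun x => (c ^+ 2)%:E * (f x ^+ 2)%:E +
  ((2 * c)%:E * (f x * g x)%:E + (g x ^+ 2)%:E))%E).
  by move=> x _; rewrite -!EFinM -!EFinD; congr EFin; ring.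
by apply: integrableD => //; [exact: integrableZl|
  apply: integrableD => //; exact: integrableZl].
Qed.

Lemma in_L2_0 : in_L2 D (fun=> 0).
Proof.
split=> //; rewrite (_ : (fun=> _) = cst 0%E); first by rewrite integral_cst// mul0e.
by apply/funext => x; rewrite expr0n.
Qed.

Lemma L2_ipC f g : L2_ip f g = L2_ip g f.
Proof. by apply: eq_Rintegral => x _; rewrite mulrC. Qed.

Lemma L2_ip_linear c f g h : in_L2 D f -> in_L2 D g -> in_L2 D h ->
  L2_ip (fun x => c * f x + g x) h = c * L2_ip f h + L2_ip g h.
Proof.
move=> f2 g2 h2; have Ifh := in_L2_integrableM f2 h2.
rewrite /L2_ip -RintegralZl// -RintegralD//; last 2 first.
- by have := integrableZl mD c Ifh.
- exact: in_L2_integrableM.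
by apply: eq_Rintegral => x _; ring.
Qed.

Lemma L2_ip_ge0 f : 0 <= L2_ip f f.
Proof. by apply: Rintegral_ge0 => x _; rewrite -expr2 sqr_ge0. Qed.

Lemma L2_ip_ae f g h : measurable_fun D f -> measurable_fun D g ->
  measurable_fun D h -> ae_eq mu D f g -> L2_ip f h = L2_ip g h.
Proof.
move=> mf mg mh fg; congr fine; apply: ae_eq_integral => //.
- by apply/measurable_EFinP; exact: measurable_funM.
- by apply/measurable_EFinP; exact: measurable_funM.
- by apply: filterS fg => x xfg xD; rewrite xfg.
Qed.

Lemma in_L2_ae f g : measurable_fun D f -> ae_eq mu D f g ->
  in_L2 D g -> in_L2 D f.
Proof.
move=> mf fg [mg Ig]; split => //; apply: le_lt_trans Ig.
rewrite le_eqVlt; apply/orP; left; apply/eqP; apply: ae_eq_integral => //.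
- by apply/measurable_EFinP; exact: measurable_funX.
- by apply/measurable_EFinP; exact: measurable_funX.
- by apply: filterS fg => x xfg xD; rewrite xfg.
Qed.

(** [Rintegral] sends an infinite integral to 0; square integrability is what makes the passage to
    extended reals faithful. *)
Lemma L2_ipE f : in_L2 D f ->
  (L2_ip f f)%:E = (\int[mu]_(x in D) (f x ^+ 2)%:E)%E.
Proof.
move=> /in_L2P[mf If]; rewrite /L2_ip /Rintegral.
under eq_integral do rewrite -expr2.
by rewrite fineK//; exact: integrable_fin_num.
Qed.

Hypothesis fD : (mu D < +oo)%E.

Lemma in_L2_cst c : in_L2 D (fun=> c).
Proof.
split=> //; rewrite (_ : (fun=> _) = cst (c ^+ 2)%:E)// integral_cst//.
by rewrite lte_mul_pinfty// lee_fin sqr_ge0.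
Qed.

Lemma in_L2_integrable f : in_L2 D f -> mu.-integrable D (EFin \o f).
Proof.
move=> f2; apply: (@eq_integrable _ _ _ mu D mD (EFin \o (fun x => f x * 1))).
  by move=> x _ /=; rewrite mulr1.
by apply: in_L2_integrableM => //; exact: in_L2_cst.
Qed.

(* AM-GM: 2 |f| <= s f^2 + 1 / s *)
Lemma L1_le_L2 f (s : R) : 0 < s -> in_L2 D f ->
  2 * Rintegral mu D (fun x => `|f x|) <= s * L2_ip f f + s^-1 * fine (mu D).
Proof.
move=> s0 f2; have If := in_L2_integrable f2; have Iff := in_L2_integrableM f2 f2.
have I2 : mu.-integrable D (EFin \o (fun x => s * (f x * f x))).
  by have := integrableZl mD s Iff.
have I1 : mu.-integrable D (EFin \o (fun=> s^-1)).
  by apply: in_L2_integrable; exact: in_L2_cst.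
have I0 : mu.-integrable D (EFin \o (fun x => `|f x|)) by exact: integrable_norm.
rewrite -Rintegral_cst// /L2_ip -RintegralZl// -RintegralZl// -RintegralD//.
apply: le_Rintegral => //.
- by have := integrableZl mD 2 I0.
- by have := integrableD mD I2 I1.
move=> x _.
have -> : f x * f x = `|f x| ^+ 2 by rewrite real_normK ?num_real// expr2.
set n := `|f x|; have := sqr_ge0 (s * n - 1) => H.
rewrite -(ler_pM2l s0) mulrDr mulfV ?gt_eqF//; nra.
Qed.

End SquareIntegrable.

(** * Completeness of L2 *)

Section RieszFischer.
Variables (R : realType) (D : set R).
Local Notation mu := (@lebesgue_measure R).
Hypothesis mD : measurable (D : set (measurableTypeR R)).
Hypothesis fD : (mu D < +oo)%E.

Lemma in_L2B (f g : R -> R) : in_L2 D f -> in_L2 D g ->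
  in_L2 D (fun x => f x - g x).
Proof.
move=> f2 g2; rewrite (_ : (fun x => f x - g x) = (fun x => -1 * g x + f x)).
  exact: in_L2_linear.
by apply/funext => x; ring.
Qed.

Lemma limn_einf_le (a : (\bar R)^nat) (e : \bar R) N :
  (forall k, (N <= k)%N -> (a k <= e)%E) -> (limn_einf a <= e)%E.
Proof.
move=> ae; rewrite limn_einf_lim; apply: lime_le; first exact: is_cvg_einfs.
near=> k; apply: le_trans (ae k _); last by near: k; exists N.
by apply: ereal_inf_lbound; exists k => //=.
Unshelve. all: end_near. Qed.

(** The L1 norms of the increments are summable, so the sum of their absolute values is integrable,
    hence finite almost everywhere; there the telescoping series converges absolutely. *)
Lemma L2_cvg_ae (h : nat -> R -> R) :
  (forall k, in_L2 D (h k)) ->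
  (forall k, L2_ip D (fun x => h k.+1 x - h k x) (fun x => h k.+1 x - h k x)
     <= ((2 ^ k.+1)%:R^-1) ^+ 2) ->
  exists C : set R, [/\ measurable (C : set (measurableTypeR R)), C `<=` D,
    {ae mu, forall x, D x -> C x} & forall x, C x -> cvgn (h ^~ x)].
Proof.
move=> h2 hh.
pose d k x : R := `|h k.+1 x - h k x|.
have d2 k : in_L2 D (fun x => h k.+1 x - h k x) by exact: in_L2B.
have md k : measurable_fun D (EFin \o d k).
  apply/measurable_EFinP; apply: measurableT_comp => //.
  by have [] := d2 k.
pose K := (1 + fine (mu D)) / 2.
have muD0 : 0 <= fine (mu D) by rewrite fine_ge0.
have K0 : 0 <= K by rewrite divr_ge0// addr_ge0.
have Id k : (\int[mu]_(x in D) (d k x)%:E <= (K / (2 ^ k.+1)%:R)%:E)%E.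
  have Ifin : mu.-integrable D (EFin \o d k).
    by apply: integrable_norm; apply: in_L2_integrable.
  rewrite -[leLHS]fineK; last exact: integrable_fin_num.
  rewrite lee_fin.
  (* Taking [s = q] in [L1_le_L2] balances its two terms: the squared L2 norm is at most the square
     of [q^-1], so both are of order [q^-1]. *)
  set q := ((2 ^ k.+1)%:R : R).
  have q0 : 0 < q by rewrite ltr0n expn_gt0.
  rewrite -(ler_pM2l (ltr0n R 2)); apply: le_trans (L1_le_L2 mD fD q0 (d2 k)) _.
  have := hh k; rewrite -/q => hk.
  have -> : 2 * (K / q) = q^-1 * (1 + fine (mu D)).
    by rewrite /K; field; rewrite gt_eqF.
  rewrite mulrDr mulr1 lerD2r.
  by rewrite -ler_pdivlMl// -expr2.
pose S x := (\sum_(k <oo) (d k x)%:E)%E.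
have mS : measurable_fun D S.
  have d0 k x : D x -> true -> (0 <= (d k x)%:E)%E.
    by move=> _ _; rewrite lee_fin normr_ge0.
  exact: (@ge0_emeasurable_sum _ _ _ D (fun k x => (d k x)%:E) xpredT d0 (fun k _ => md k)).
have IS : (\int[mu]_(x in D) S x < +oo)%E.
  have d0 k x : D x -> (0 <= (EFin \o d k) x)%E by move=> _; rewrite lee_fin normr_ge0.
  rewrite (integral_nneseries mu mD md d0).
  apply: (@le_lt_trans _ _ (\sum_(k <oo) (K / (2 ^ k.+1)%:R)%:E)%E).
    apply: lee_nneseries; last by move=> k _; exact: Id.
    by move=> k _ _; apply: integral_ge0 => x _; rewrite lee_fin normr_ge0.
  by apply: le_lt_trans (epsilon_trick0 _ K0) _; exact: ltry.
have S0 x : (0 <= S x)%E by apply: nneseries_ge0 => k _ _; rewrite lee_fin normr_ge0.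
have intS : mu.-integrable D S.
  apply/integrableP; split => //.
  apply: le_lt_trans IS; rewrite le_eqVlt; apply/orP; left; apply/eqP.
  by apply: eq_integral => x _; rewrite gee0_abs.
pose C := D `&` S @^-1` (~` [set +oo%E]).
exists C; split.
- by apply: mS => //; apply: measurableC; exact: emeasurable_set1.
- by move=> x [].
- have := integrable_ae mD intS; apply: filterS => x xS Dx; split => //=.
  by move=> Sy; have := xS Dx; rewrite Sy.
move=> x [Dx Sx].
have SE : S x = (fine (S x))%:E by rewrite fineK// ge0_fin_numE// ltey; exact/eqP.
have cs : cvgn [normed series (telescope (h ^~ x))].
  apply: nondecreasing_is_cvgn.
    apply: nondecreasing_series => n _ _; exact: normr_ge0.
  exists (fine (S x)) => _ [n _ <-] /=.
  rewrite -lee_fin -SE /series/= -sumEFin.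
  by apply: nneseries_lim_ge.
have := normed_cvg cs.
rewrite telescopeK => c.
have -> : h ^~ x = (fun n => (h n x - h 0%N x) + h 0%N x).
  by apply/funext => n; rewrite subrK.
by apply: is_cvgD => //; exact: is_cvg_cst.
Qed.

Theorem L2_complete (f : nat -> R -> R) :
  (forall n, in_L2 D (f n)) ->
  (forall e, 0 < e -> exists N, forall m n, (N <= m)%N -> (N <= n)%N ->
     L2_ip D (fun x => f m x - f n x) (fun x => f m x - f n x) <= e) ->
  exists2 g, in_L2 D g &
    forall e, 0 < e -> exists N, forall n, (N <= n)%N ->
      L2_ip D (fun x => f n x - g x) (fun x => f n x - g x) <= e.
Proof.
move=> f2 cf.
have qk0 (k : nat) : 0 < ((2 ^ k.+1)%:R^-1 : R) ^+ 2.
  by rewrite exprn_gt0// invr_gt0 ltr0n expn_gt0.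
have [N NP] := choice (fun k => cf _ (qk0 k)).
(* The sum makes [phi] nondecreasing and at least [N k]; the summand [k] makes it tend to
   infinity. *)
pose phi k := (k + \sum_(i < k.+1) N i)%N.
have Nphi k : (N k <= phi k)%N by rewrite /phi big_ord_recr/= addnA leq_addl.
have phiS k : (phi k <= phi k.+1)%N by rewrite /phi [in leqRHS]big_ord_recr/= leq_add ?leq_addr.
pose h k := f (phi k).
have [C [mC CD aeC cC]] : exists C : set R,
    [/\ measurable (C : set (measurableTypeR R)), C `<=` D,
      {ae mu, forall x, D x -> C x} & forall x, C x -> cvgn (h ^~ x)].
  apply: L2_cvg_ae => k; first exact: f2.
  by apply: NP => //; exact: leq_trans (phiS k).
(* Cutting off outside [C] makes the subsequence converge everywhere, so that its limit is
   measurable as a pointwise limit. *)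
pose h' k := h k \_ C.
have mh' k : measurable_fun D (h' k).
  apply/measurable_restrict => //; rewrite setIC.
  by apply: measurable_funS (f2 (phi k)).1 => // x [].
have hh' k : ae_eq mu D (h' k) (h k).
  move: aeC; apply: (@filterS _ _ (ae_filter_ringOfSetsType mu)) => x xC Dx.
  by rewrite /h' patchE mem_set//; exact: xC.
have h'2 k : in_L2 D (h' k) by apply: in_L2_ae (hh' k) (f2 _).
have ch' x : cvgn (h' ^~ x).
  have [Cx|nCx] := pselect (C x).
    rewrite (_ : h' ^~ x = h ^~ x); first exact: cC.
    by apply/funext => k; rewrite /h' patchE mem_set.
  rewrite (_ : h' ^~ x = fun=> 0); first exact: is_cvg_cst.
  by apply/funext => k; rewrite /h' patchE memNset.
pose g x := lim (h' ^~ x @ \oo).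
have h'g x : h' ^~ x @ \oo --> g x by exact: ch'.
have mg : measurable_fun D g.
  by apply: (@measurable_fun_cvg _ _ _ _ h') => // x _; exact: h'g.
(* Fatou's lemma along the subsequence, with [n] fixed: a bound on the distances from [f n] to late
   terms is inherited by the limit [g]. *)
have key e n M : (forall k, (M <= k)%N ->
    L2_ip D (fun x => f n x - f k x) (fun x => f n x - f k x) <= e) ->
  (\int[mu]_(x in D) ((f n x - g x) ^+ 2)%:E <= e%:E)%E.
  move=> ne.
  pose F k x := ((f n x - h' k x) ^+ 2)%:E.
  have mF k : measurable_fun D (F k).
    apply/measurable_EFinP; apply: measurable_funX; apply: measurable_funB => //.
    by have [] := f2 n.
  have F0 k x : D x -> (0 <= F k x)%E by move=> _; rewrite lee_fin sqr_ge0.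
  have := fatou mu mD mF F0.
  rewrite (_ : (\int[mu]_(x in D) limn_einf (F ^~ x))%E =
    (\int[mu]_(x in D) ((f n x - g x) ^+ 2)%:E)%E).
    move=> /le_trans; apply; apply: (@limn_einf_le _ _ M) => k Mk.
    rewrite -(L2_ipE mD); last exact: in_L2B.
    rewrite lee_fin.
    have Mphi : (M <= phi k)%N by rewrite (leq_trans Mk)// leq_addr.
    apply: le_trans (ne (phi k) Mphi).
    rewrite le_eqVlt; apply/orP; left; apply/eqP.
    have E : ae_eq mu D (fun x => f n x - h' k x) (fun x => f n x - f (phi k) x).
      by move: (hh' k); apply: (@filterS _ _ (ae_filter_ringOfSetsType mu)) => x + Dx => ->.
    have m1 : measurable_fun D (fun x => f n x - h' k x) by case: (in_L2B (f2 n) (h'2 k)).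
    have m2 : measurable_fun D (fun x => f n x - f (phi k) x) by case: (in_L2B (f2 n) (f2 (phi k))).
    rewrite (L2_ip_ae mD m1 m2 m1 E) L2_ipC.
    exact: (L2_ip_ae mD m1 m2 m2 E).
  apply: eq_integral => x _.
  have cF : F ^~ x @ \oo --> ((f n x - g x) ^+ 2)%:E.
    apply: cvg_EFin; first by exact: nearW.
    have cfg : f n x - h' k x @[k --> \oo] --> f n x - g x.
      by apply: cvgB; [exact: cvg_cst|exact: h'g].
    exact: (cvgM cfg cfg).
  by have [-> _] := cvg_limn_einf_sup cF.
have [N0 N0P] := cf 1 ltr01.
have fg2 : in_L2 D (fun x => f N0 x - g x).
  split; first by apply: measurable_funB => //; case: (f2 N0).
  by apply: le_lt_trans (key 1 N0 N0 _) (ltry _) => k; exact: N0P.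
have g2 : in_L2 D g.
  rewrite (_ : g = fun x => f N0 x - (f N0 x - g x)); first exact: in_L2B.
  by apply/funext => x; ring.
exists g => // e e0; have [M MP] := cf e e0.
exists M => n Mn; rewrite -lee_fin L2_ipE//; last exact: in_L2B.
by apply: (key e n M) => k; exact: MP.
Qed.

End RieszFischer.

(** * Primitives *)

Section Primitive.
Variables (R : realType) (a T : R).
Hypothesis aT : a < T.
Local Notation D := [set` `[a, T]].
Local Notation mu := (@lebesgue_measure R).
Implicit Types (f g u v w : R -> R).

Lemma measurable_segment : measurable (D : set (measurableTypeR R)).
Proof. exact: measurable_itv. Qed.

Lemma lebesgue_open_itv s t : s <= t -> mu [set` `]s, t[] = (t - s)%:E.
Proof.
move=> st; rewrite lebesgue_measure_itv/= lte_fin EFinB.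
by case: ltgtP st => // -> _; rewrite subee.
Qed.

Lemma lebesgue_segment : mu D = (T - a)%:E.
Proof. by rewrite lebesgue_measure_itv/= lte_fin aT EFinB. Qed.

Lemma lebesgue_segment_lty : (mu D < +oo)%E.
Proof. by rewrite lebesgue_segment ltry. Qed.

Lemma open_itv_sub_segment s t : a <= s -> t <= T -> [set` `]s, t[] `<=` D.
Proof.
move=> as_ tT x /=; rewrite !in_itv/= => /andP[sx xt]; apply/andP; split.
  exact: le_trans as_ (ltW sx).
exact: le_trans (ltW xt) tT.
Qed.

Lemma in_L2S (A : set R) g : measurable (A : set (measurableTypeR R)) ->
  A `<=` D -> in_L2 D g -> in_L2 A g.
Proof.
move=> mA AD /in_L2P[mg Ig]; apply/in_L2P => //; split.
  exact: measurable_funS mg.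
exact: integrableS Ig.
Qed.

Definition primitive g x := Rintegral mu [set` `[a, x]] g.

Lemma primitive0 g : primitive g a = 0.
Proof. by rewrite /primitive set_itv1 Rintegral_set1. Qed.

Lemma primitiveB g s t : mu.-integrable D (EFin \o g) ->
  a <= s -> s <= t -> t <= T ->
  primitive g t - primitive g s = Rintegral mu [set` `]s, t[] g.
Proof.
move=> Ig as_ st tT.
have Iat : mu.-integrable [set` `[a, t]] (EFin \o g).
  apply: integrableS Ig => // x /=; rewrite !in_itv/= => /andP[-> xt].
  exact: le_trans tT.
rewrite /primitive Rintegral_itvB ?bnd_simp//.
rewrite -Rintegral_itv_bndo_bndc//.
apply: integrableS Iat => // x /=; rewrite !in_itv/= => /andP[sx xt].
by rewrite (ltW xt) (le_trans as_ (ltW sx)).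
Qed.

(** Apply [L1_le_L2] on each interval and sum: by disjointness, twice the total variation is at most
    [r * K] plus the total length divided by [r]. *)
Lemma primitive_abs_continuous g : in_L2 D g -> abs_continuous a T (primitive g).
Proof.
move=> g2 e e0.
have Ig := in_L2_integrable measurable_segment lebesgue_segment_lty g2.
pose K := L2_ip D g g; have K0 : 0 <= K by exact: L2_ip_ge0.
(* This [r] keeps [r * K] below [e]; a total length below [r * e] then does the same for the other
   term. *)
pose r := e / (K + 1); have r0 : 0 < r by rewrite divr_gt0// ltr_wpDl.
have rK : r * K < e.
  by rewrite /r mulrAC ltr_pdivrMr ?ltr_wpDl// ltr_pM2l// ltrDl.
exists (r * e); first exact: mulr_gt0.
move=> n s t st dis small.
pose E i : set R := [set` `]s i, t i[].
have mE i : measurable (E i : set (measurableTypeR R)) by exact: measurable_itv.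
have ED i : E i `<=` D.
  by have [? [_ ?]] := st i; exact: open_itv_sub_segment.
have E2 i : in_L2 (E i) g by exact: in_L2S.
have one i : 2 * `|primitive g (t i) - primitive g (s i)| <=
    r * L2_ip (E i) g g + r^-1 * (t i - s i).
  have [as_ [sti tT]] := st i.
  have fE : (mu (E i) < +oo)%E by rewrite lebesgue_open_itv// ltry.
  have := L1_le_L2 (mE i) fE r0 (E2 i); rewrite lebesgue_open_itv//=; apply: le_trans.
  rewrite ler_pM2l// primitiveB//; apply: le_normr_Rintegral; first exact: mE.
  exact: (in_L2_integrable (mE i) fE (E2 i)).
have sumE : \sum_(i < n) L2_ip (E i) g g <= K.
  rewrite -lee_fin -sumEFin.
  under eq_bigr do rewrite (L2_ipE (mE _) (E2 _)).
  rewrite (L2_ipE measurable_segment g2).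
  have mg2 : measurable_fun D (fun x => (g x ^+ 2)%:E).
    by apply/measurable_EFinP; apply: measurable_funX; case: g2.
  have trE : trivIset [set` index_enum 'I_n] E.
    move=> i j _ _ /set0P; apply: contraNeq => ij.
    by rewrite /E dis.
  have UD : \big[setU/set0]_(i <- index_enum 'I_n) E i `<=` D.
    by rewrite -bigcup_seq => x [i _ /ED].
  have mU : measurable (\big[setU/set0]_(i <- index_enum 'I_n) E i : set (measurableTypeR R)).
    exact: bigsetU_measurable.
  rewrite -(@ge0_integral_bigsetU _ _ _ mu _ E (fun x => (g x ^+ 2)%:E)
    _ mE (index_enum_uniq _) trE).
  - apply: ge0_subset_integral => //.
    by move=> x _; rewrite lee_fin sqr_ge0.
  - exact: measurable_funS mg2.
  - by move=> x _; rewrite lee_fin sqr_ge0.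
rewrite -(ltr_pM2l (ltr0n R 2)) mulr_sumr.
apply: (@le_lt_trans _ _ (\sum_(i < n) (r * L2_ip (E i) g g + r^-1 * (t i - s i)))).
  exact: ler_sum.
rewrite big_split/= -!mulr_sumr mulr2n mulrDl mul1r.
apply: ler_ltD; first by apply: le_trans (ltW rK); rewrite ler_pM2l.
by rewrite ltr_pdivrMl.
Qed.

Lemma ae_neq (c : R) : {ae mu, forall x, x <> c}.
Proof.
exists [set c]; split; [exact: measurable_set1|exact: lebesgue_measure_set1|].
by move=> x /= /contrapT.
Qed.

Lemma primitive_derive_ae g : in_L2 D g ->
  {ae mu, forall x, x \in `[a, T] ->
    derivable_in D (primitive g) x /\ derive_in D (primitive g) x = g x}.
Proof.
move=> g2; have Ig := in_L2_integrable measurable_segment lebesgue_segment_lty g2.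
have := lebesgue_differentiation (integrable_locally measurable_segment Ig).
(* The endpoints form a null set; elsewhere the two-sided derivative given by Lebesgue's theorem
   agrees with the relative one. *)
apply: (@filterS3 _ _ (ae_filter_ringOfSetsType mu) _ _ _ _ _
  (ae_neq a) (ae_neq T)) => x xa xT lx xD.
have [ax xT'] : a < x /\ x < T.
  move: xD; rewrite in_itv/= !le_eqVlt => /andP[/predU1P[ax|->]].
    by move: xa; rewrite ax.
  by move=> /predU1P[].
have IgD : mu.-integrable [set` `[a, T]] (EFin \o (g \_ D)).
  apply: (@eq_integrable _ _ _ mu D measurable_segment (EFin \o g)) => //.
  by move=> y yD /=; rewrite patchE yD.
have [] := @FTC1_lebesgue_pt R (g \_ D) (BLeft a) x T xT' IgD _ lx.
  by [].
move=> dF FE; have [dF' FE'] := derivable_derive_in aT xD dF.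
have FP : {in `[a, T], (fun y => Rintegral mu [set` `[a, y]] (g \_ D)) =1 primitive g}.
  move=> y; rewrite in_itv/= => /andP[ay yT]; apply: eq_Rintegral => z zI.
  rewrite mem_set//; move: zI => /set_mem /=; rewrite !in_itv/=.
  by move=> /andP[-> zy]; exact: le_trans yT.
split; first exact: eq_derivable_in FP dF'.
rewrite -(eq_derive_in xD FP) FE' FE patchE mem_set//.
Qed.

(** Membership in W23 asks for derivatives at every point, endpoints included, which the
    almost-everywhere version does not give; continuity of [g] does. *)
Lemma primitive_derive g x : mu.-integrable D (EFin \o g) ->
  rel_continuous a T g -> x \in `[a, T] ->
  derivable_in D (primitive g) x /\ derive_in D (primitive g) x = g x.
Proof.
move=> Ig cg xD; apply: derive_inE => //.
(* The average of [g] over an interval is as close to [c] as [g] is; this serves for intervals on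
   either side of [x]. *)
have mean s t c e : 0 <= e -> a <= s -> s < t -> t <= T ->
    (forall y, y \in `]s, t[ -> `|g y - c| <= e) ->
    `|(primitive g t - primitive g s) / (t - s) - c| <= e.
  move=> e0 as_ st tT ge.
  have ts0 : 0 < t - s by rewrite subr_gt0.
  have mI : measurable ([set` `]s, t[] : set (measurableTypeR R)) by exact: measurable_itv.
  have Ist : mu.-integrable [set` `]s, t[] (EFin \o g).
    by apply: integrableS Ig => //; exact: open_itv_sub_segment.
  have fI : (mu [set` `]s, t[] < +oo)%E by rewrite lebesgue_open_itv ?ltW// ltry.
  have Ic (k : R) : mu.-integrable [set` `]s, t[] (EFin \o (fun=> k)).
    exact: (in_L2_integrable mI fI (in_L2_cst mI fI k)).
  have Ec (k : R) : Rintegral mu [set` `]s, t[] (fun=> k) = k * (t - s).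
    rewrite (Rintegral_cst mu mI); congr (_ * _).
    by rewrite [X in fine X](lebesgue_open_itv (ltW st)).
  have -> : (primitive g t - primitive g s) / (t - s) - c =
      Rintegral mu [set` `]s, t[] (fun y => g y - c) / (t - s).
    rewrite (RintegralB mI Ist (Ic c)) Ec (primitiveB Ig as_ (ltW st) tT).
    by rewrite mulrBl mulfK// lt0r_neq0.
  rewrite normrM normfV [`|t - s|]gtr0_norm// ler_pdivrMr//.
  have IB : mu.-integrable [set` `]s, t[] (EFin \o (fun y => g y - c)).
    by have := integrableB mI Ist (Ic c).
  apply: le_trans (le_normr_Rintegral mI IB) _.
  rewrite -Ec; apply: le_Rintegral => //.
  by have := integrable_norm IB.
apply/cvg_diff_quotientP => e e0.
have [d d0 dP] := cg x xD (e / 2) ltac:(by rewrite divr_gt0).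
exists d => // y yD yx yxd.
have e2 : e / 2 < e by rewrite ltr_pdivrMr// ltr_pMr// ltr1n.
apply: le_lt_trans e2; rewrite /diff_quotient.
have e20 : 0 <= e / 2 by rewrite divr_ge0// ltW.
have := xD; have := yD; rewrite !in_itv/= => /andP[ay yT] /andP[ax xT].
have [xy|xy] := ltP x y.
  apply: mean => // z; rewrite in_itv/= => /andP[xz zy].
  apply/ltW/dP; first by rewrite in_itv/= (le_trans ax (ltW xz)) (le_trans (ltW zy) yT).
  by apply: le_lt_trans yxd; rewrite !gtr0_norm ?subr_gt0// lerD2r ltW.
have {}yx : y < x by rewrite lt_neqAle yx.
rewrite -[primitive g y - _]opprB -[y - x]opprB invrN mulrNN.
apply: mean => // z; rewrite in_itv/= => /andP[yz zx].
apply/ltW/dP; first by rewrite in_itv/= (le_trans ay (ltW yz)) (le_trans (ltW zx) xT).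
by apply: le_lt_trans yxd; rewrite !ltr0_norm ?subr_lt0// !opprB lerD2l lerN2 ltW.
Qed.

End Primitive.

(** * The space W21 and its reproducing kernel *)

Section W21Theory.
Variables (R : realType) (a T : R).
Hypothesis aT : a < T.
Local Notation D := [set` `[a, T]].
Local Notation mu := (@lebesgue_measure R).
Local Notation "u ^'" := (derive_in D u).
Implicit Types (c : R) (f g u v w : R -> R).

Let mD : measurable (D : set (measurableTypeR R)) := measurable_segment a T.
Let fD : (mu D < +oo)%E := lebesgue_segment_lty aT.

Lemma left_mem_segment : a \in `[a, T]. Proof. by rewrite in_itv/= lexx ltW. Qed.

Lemma W21_rel_continuous u : W21 a T u -> rel_continuous a T u.
Proof. by move=> [/abs_continuous_rel_continuous]. Qed.

(** Almost-everywhere equality with [g] does not by itself make the derivative Borel measurable;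
    [measurable_derive_in] supplies this, and [g] then gives the integral bound. *)
Lemma W21_of_ae u g : abs_continuous a T u -> in_L2 D g ->
  {ae mu, forall x, x \in `[a, T] -> derivable_in D u x /\ u^' x = g x} ->
  W21 a T u /\ ae_eq mu D (u^') g.
Proof.
move=> acu g2 dug.
have E : ae_eq mu D (u^') g.
  by move: dug; apply: (@filterS _ _ (ae_filter_ringOfSetsType mu)) => x H /H[].
split=> //; split=> //.
  by move: dug; apply: (@filterS _ _ (ae_filter_ringOfSetsType mu)) => x H /H[].
apply: in_L2_ae E g2 => //; apply: measurable_derive_in => //.
exact: abs_continuous_rel_continuous.
Qed.

Lemma W21_linear c u v : W21 a T u -> W21 a T v ->
  W21 a T (fun x => c * u x + v x) /\
  ae_eq mu D ((fun x => c * u x + v x)^') (fun x => c * u^' x + v^' x).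
Proof.
move=> [acu du u2] [acv dv v2].
apply: W21_of_ae; first exact: abs_continuous_linear.
  exact: in_L2_linear.
move: du dv; apply: (@filterS2 _ _ (ae_filter_ringOfSetsType mu)) => x du dv xD.
by apply: derive_in_linear => //; [exact: du|exact: dv].
Qed.

(** Produces elements of W21 with prescribed derivative and initial value: the limit in the
    completeness theorem, and the test functions for the kernel. *)
Lemma W21_primitive c g : in_L2 D g ->
  let v := fun x => primitive a g x + c in
  [/\ W21 a T v, ae_eq mu D (v^') g & v a = c].
Proof.
move=> g2 v; have acv : abs_continuous a T v.
  move=> e e0; have [d d0 H] := primitive_abs_continuous aT g2 e0.
  exists d => // n s t st dis l.
  rewrite (eq_bigr (fun i => `|primitive a g (t i) - primitive a g (s i)|)).
    exact: H.
  by move=> i _; rewrite /v opprD addrACA subrr addr0.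
have dv : {ae mu, forall x, x \in `[a, T] -> derivable_in D v x /\ v^' x = g x}.
  move: (primitive_derive_ae aT g2).
  apply: (@filterS _ _ (ae_filter_ringOfSetsType mu)) => x H xD.
  have [d1 d2] := H xD.
  have dq : diff_quotient v x = diff_quotient (primitive a g) x.
    by apply/funext => y; rewrite /diff_quotient /v opprD addrACA subrr addr0.
  by rewrite /derivable_in /derive_in dq.
have [? ?] := W21_of_ae acv g2 dv.
by split=> //; rewrite /v primitive0 add0r.
Qed.

Lemma W21_cst c : W21 a T (fun=> c) /\ ae_eq mu D ((fun=> c)^') (fun=> 0).
Proof.
apply: W21_of_ae => [|| /=]; last 2 first.
- exact: in_L2_0.
- apply: aeW => x xD; apply: derive_inE => //.
  rewrite (_ : diff_quotient _ _ = fun=> 0).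
    have PF := within_itv_proper aT xD.
    exact: cvg_cst.
  by apply/funext => y; rewrite /diff_quotient subrr mul0r.
move=> e e0; exists 1 => // n s t _ _ _.
by rewrite big1// => i _; rewrite subrr normr0.
Qed.

Lemma W21_ext u v : {in `[a, T], u =1 v} -> W21 a T u -> W21 a T v.
Proof.
move=> uv [acu du u2].
have E : {in `[a, T], forall x, u^' x = v^' x}.
  by move=> x xD; exact: eq_derive_in.
split; first exact: abs_continuous_ext acu.
  move: du; apply: (@filterS _ _ (ae_filter_ringOfSetsType mu)) => x H xD.
  by apply: (eq_derivable_in xD uv); exact: H.
apply: (@in_L2_ae _ _ mD _ (u^')) => //.
  by apply: eq_measurable_fun u2.1 => x /set_mem; exact: E.
by apply: aeW => x xD; rewrite E.
Qed.

Lemma W21_ipE u v : W21_ip a T u v = u a * v a + L2_ip D (u^') (v^').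
Proof. by []. Qed.

Lemma W21_ipC u v : W21_ip a T u v = W21_ip a T v u.
Proof. by rewrite !W21_ipE mulrC L2_ipC. Qed.

Lemma W21_ip_ge0 u : 0 <= W21_ip a T u u.
Proof. by rewrite W21_ipE addr_ge0 ?L2_ip_ge0// -expr2 sqr_ge0. Qed.

Lemma W21_ip_linear c u v w : W21 a T u -> W21 a T v -> W21 a T w ->
  W21_ip a T (fun x => c * u x + v x) w = c * W21_ip a T u w + W21_ip a T v w.
Proof.
move=> Wu Wv Ww; have [[_ _ uv2] E] := W21_linear c Wu Wv.
have [_ _ u2] := Wu; have [_ _ v2] := Wv; have [_ _ w2] := Ww.
rewrite !W21_ipE (L2_ip_ae mD uv2.1 (in_L2_linear mD c u2 v2).1 w2.1 E).
by rewrite L2_ip_linear//; ring.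
Qed.

Lemma W21_ip_ext u u' v v' : {in `[a, T], u =1 u'} -> {in `[a, T], v =1 v'} ->
  W21_ip a T u v = W21_ip a T u' v'.
Proof.
move=> uu vv; rewrite !W21_ipE uu ?left_mem_segment// vv ?left_mem_segment//; congr (_ + _).
apply: eq_Rintegral => x /set_mem/= xD.
by rewrite (eq_derive_in xD uu) (eq_derive_in xD vv).
Qed.

Lemma W21B u v : W21 a T u -> W21 a T v ->
  W21 a T (fun x => u x - v x) /\
  ae_eq mu D ((fun x => u x - v x)^') (fun x => u^' x - v^' x).
Proof.
move=> Wu Wv; rewrite (_ : (fun x => u x - v x) = (fun x => -1 * v x + u x)).
  have [? E] := W21_linear (-1) Wv Wu; split=> //.
  move: E; apply: (@filterS _ _ (ae_filter_ringOfSetsType mu)) => x H /H ->; ring.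
by apply/funext => x; ring.
Qed.

Lemma W21_ipBB u v : W21 a T u -> W21 a T v ->
  W21_ip a T (fun x => u x - v x) (fun x => u x - v x) =
  (u a - v a) ^+ 2 +
  L2_ip D (fun x => u^' x - v^' x) (fun x => u^' x - v^' x).
Proof.
move=> Wu Wv; have [[_ _ uv2] E] := W21B Wu Wv.
have [_ _ u2] := Wu; have [_ _ v2] := Wv.
have b2 := in_L2B mD u2 v2.
rewrite W21_ipE -expr2; congr (_ + _).
rewrite (L2_ip_ae mD uv2.1 b2.1 uv2.1 E) L2_ipC.
exact: (L2_ip_ae mD uv2.1 b2.1 b2.1 E).
Qed.

Theorem W21_complete (f : nat -> R -> R) : (forall n, W21 a T (f n)) ->
  (forall e, 0 < e -> exists N, forall m n, (N <= m)%N -> (N <= n)%N ->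
     W21_ip a T (fun x => f m x - f n x) (fun x => f m x - f n x) <= e) ->
  exists2 g, W21 a T g &
    forall e, 0 < e -> exists N, forall n, (N <= n)%N ->
      W21_ip a T (fun x => f n x - g x) (fun x => f n x - g x) <= e.
Proof.
move=> Wf cf.
have f2 n : in_L2 D ((f n)^') by have [] := Wf n.
have [g g2 gP] : exists2 g, in_L2 D g & forall e, 0 < e -> exists N, forall n, (N <= n)%N ->
    L2_ip D (fun x => (f n)^' x - g x) (fun x => (f n)^' x - g x) <= e.
  apply: L2_complete => // e e0; have [N NP] := cf e e0.
  exists N => m n Nm Nn; apply: le_trans (NP m n Nm Nn).
  by rewrite W21_ipBB// lerDr sqr_ge0.
have [l fl] : exists l : R, f n a @[n --> \oo] --> l.
  apply/cvg_ex; apply: cauchy_cvg; apply: cauchy_exP => e e0.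
  have [N NP] := cf ((e / 2) ^+ 2) ltac:(by rewrite exprn_gt0// divr_gt0).
  exists (f N a); exists N => // n /= Nn.
  have := NP N n (leqnn _) Nn; rewrite W21_ipBB// => H.
  have e2 : e / 2 < e by rewrite ltr_pdivrMr// ltr_pMr// ltr1n.
  rewrite /ball/=; apply: (le_lt_trans _ e2); rewrite -ler_sqr ?nnegrE ?divr_ge0 ?(ltW e0)//.
  rewrite real_normK ?num_real//; apply: le_trans H.
  by rewrite lerDl L2_ip_ge0.
pose v x := primitive a g x + l.
have [Wv Ev va] : [/\ W21 a T v, ae_eq mu D (v^') g & v a = l] := W21_primitive l g2.
exists v => // e e0.
have [N1 N1P] := gP (e / 2) ltac:(by rewrite divr_gt0).
(* A real of absolute value at most [r] has square at most [r * 1], hence at most [e / 2]. *)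
pose r := Num.min 1 (e / 2).
have r0 : 0 < r by rewrite lt_min ltr01 divr_gt0.
have /cvgrPdist_lt/(_ r r0)[N2 _ N2P] := fl.
exists (maxn N1 N2) => n; rewrite geq_max => /andP[N1n N2n].
rewrite W21_ipBB// [e]splitr va.
have [_ _ v2] := Wv.
have [_ E] := W21B (Wf n) Wv.
apply: lerD.
  have := N2P n N2n; rewrite distrC => /ltW H.
  have r1 : r <= 1 by rewrite ge_min lexx.
  have re : r <= e / 2 by rewrite ge_min lexx orbT.
  rewrite -real_normK ?num_real// expr2.
  have H0 := normr_ge0 (f n a - l).
  apply: le_trans (ler_pM H0 H0 H (le_trans H r1)) _.
  by rewrite mulr1.
apply: le_trans (N1P n N1n); rewrite le_eqVlt; apply/orP; left; apply/eqP.
have b2 := in_L2B mD (f2 n) v2.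
have c2 := in_L2B mD (f2 n) g2.
have E' : ae_eq mu D (fun x => (f n)^' x - v^' x) (fun x => (f n)^' x - g x).
  by move: Ev; apply: (@filterS _ _ (ae_filter_ringOfSetsType mu)) => x H /H ->.
rewrite (L2_ip_ae mD b2.1 c2.1 b2.1 E') L2_ipC.
exact: (L2_ip_ae mD b2.1 c2.1 c2.1 E').
Qed.

Lemma W21_ip_quadratic s u v : W21 a T u -> W21 a T v ->
  W21_ip a T (fun x => s * u x + v x) (fun x => s * u x + v x) =
  s ^+ 2 * W21_ip a T u u + 2 * s * W21_ip a T u v + W21_ip a T v v.
Proof.
move=> Wu Wv; have [Wuv _] := W21_linear s Wu Wv.
rewrite W21_ip_linear// (W21_ipC u) (W21_ipC v) !W21_ip_linear// (W21_ipC v u).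
ring.
Qed.

Lemma discriminant_le (A B C : R) : 0 <= A ->
  (forall s, 0 <= s ^+ 2 * A + 2 * s * B + C) -> B ^+ 2 <= A * C.
Proof.
rewrite le_eqVlt => /predU1P[<-|Ap] H.
  have [->|B0] := eqVneq B 0; first by rewrite mul0r expr0n.
  (* The form is affine in [s] when its leading coefficient is 0; this [s] gives it the value -1. *)
  have := H (- (C + 1) / (2 * B)); rewrite mulr0 add0r.
  have -> : 2 * (- (C + 1) / (2 * B)) * B = - (C + 1) by field.
  by rewrite opprD addrAC addNr add0r oppr_ge0 ler10.
have nA0 := lt0r_neq0 Ap.
(* The minimiser of the quadratic. *)
have := H (- (B / A)).
have -> : (- (B / A)) ^+ 2 * A + 2 * (- (B / A)) * B + C = C - B ^+ 2 / A by field.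
by rewrite subr_ge0 ler_pdivrMr// mulrC.
Qed.

Lemma W21_CauchySchwarz u v : W21 a T u -> W21 a T v ->
  W21_ip a T u v ^+ 2 <= W21_ip a T u u * W21_ip a T v v.
Proof.
move=> Wu Wv; apply: discriminant_le => [|s]; first exact: W21_ip_ge0.
by rewrite -W21_ip_quadratic//; exact: W21_ip_ge0.
Qed.

Let ind (z : R) : R -> R := \1_[set` `[a, z]].

Lemma in_L2_ind z : in_L2 D (ind z).
Proof.
have mi : measurable_fun D (ind z).
  by apply: measurable_funTS; exact: measurable_indic.
apply/in_L2P; split=> //.
apply: (@le_integrable _ _ _ mu D mD _ (EFin \o (fun=> 1))).
- by apply/measurable_EFinP; exact: measurable_funX.
- move=> x _; rewrite !abse_EFin lee_fin normr1 ger0_norm ?sqr_ge0//.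
  by rewrite /ind indicE; case: (_ \in _); rewrite ?expr1n ?expr0n.
- exact: (in_L2_integrable mD fD (in_L2_cst mD fD 1)).
Qed.

Lemma primitive_ind g z : z \in `[a, T] -> primitive a g z = L2_ip D (ind z) g.
Proof.
rewrite in_itv/= => /andP[az zT]; rewrite /L2_ip Rintegral_mkcond /primitive.
rewrite Rintegral_mkcond; congr Rintegral; apply/funext => x.
rewrite /patch /ind indicE; have [xz|xz] := boolP (x \in [set` `[a, z]]).
  suff -> : x \in D by rewrite mul1r.
  move: xz; rewrite !inE/= !in_itv/= => /andP[-> xz]; exact: le_trans zT.
by case: ifP => _ //; rewrite mul0r.
Qed.

(* Testing the kernel against the primitives of indicators of [a, x] gives the
   integrals of (G y)' over [a, x], hence (G y)' itself, with no integration of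
   absolutely continuous functions. *)
Lemma W21_kernel_sqnorm (G : R -> R -> R) (y : R) : is_kernel_W21 a T G ->
  y \in `[a, T] -> W21_ip a T (G y) (G y) = 1 + (y - a).
Proof.
move=> GP yD.
have [WG repr] := GP y yD.
have G2 : in_L2 D ((G y)^') by case: WG.
have Ga : G y a = 1.
  have [W1 E1] := W21_cst 1; have := repr _ W1.
  rewrite W21_ipE mul1r (L2_ip_ae mD _ (in_L2_0 mD).1 G2.1 E1); last by case: W1 => _ _ [].
  rewrite /L2_ip (_ : (fun t => _) = fun=> 0); last by apply/funext => t; rewrite mul0r.
  by rewrite Rintegral_cst// mul0r addr0.
have P x : x \in `[a, T] -> primitive a ((G y)^') x = primitive a (ind y) x.
  move=> xD.
  have [WH EH Ha] := W21_primitive 1 (in_L2_ind x).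
  have := repr _ WH.
  rewrite W21_ipE Ha Ga mul1r (L2_ip_ae mD _ (in_L2_ind x).1 G2.1 EH); last by case: WH => _ _ [].
  (* After the initial values cancel, the two sides agree by symmetry: both are inner products of
     the indicators of [[a, x]] and [[a, y]]. *)
  rewrite -primitive_ind// addrC => /addIr ->.
  by rewrite !primitive_ind// L2_ipC.
have EG : ae_eq mu D ((G y)^') (ind y).
  move: (primitive_derive_ae aT G2) (primitive_derive_ae aT (in_L2_ind y)).
  apply: (@filterS2 _ _ (ae_filter_ringOfSetsType mu)) => x h1 h2 xD.
  have [_ <-] := h1 xD; have [_ <-] := h2 xD.
  by apply: eq_derive_in => // z zD; exact: P.
rewrite W21_ipE Ga mulr1; congr (_ + _).
rewrite (L2_ip_ae mD G2.1 (in_L2_ind y).1 G2.1 EG) -primitive_ind// P//.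
rewrite (_ : primitive a (ind y) y = Rintegral mu [set` `[a, y]] (fun=> 1)); last first.
  by apply: eq_Rintegral => x xy; rewrite /ind /indic xy.
have ay : a <= y by move: yD; rewrite in_itv/= => /andP[].
have muE : mu [set` `[a, y]] = (y - a)%:E.
  rewrite lebesgue_measure_itv/= lte_fin EFinB.
  by case: ltgtP ay => // -> _; rewrite subee.
by rewrite Rintegral_cst// mul1r [X in fine X]muE.
Qed.

(** Cauchy-Schwarz applied to the reproducing identity; the squared norm [1 + (y - a)] of the kernel
    is largest at [y = T]. *)
Lemma W21_sup_bound (G : R -> R -> R) (u : R -> R) y : is_kernel_W21 a T G ->
  W21 a T u -> y \in `[a, T] ->
  `|u y| <= Num.sqrt (1 + (T - a)) * W21_norm a T u.
Proof.
move=> GP Wu yD; have [WG repr] := GP y yD.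
rewrite -sqrtr_sqr /W21_norm -sqrtrM; last by rewrite addr_ge0// subr_ge0 ltW.
rewrite ler_wsqrtr// -repr//; apply: le_trans (W21_CauchySchwarz Wu WG) _.
rewrite mulrC ler_wpM2r ?W21_ip_ge0// W21_kernel_sqnorm// lerD2l lerD2r.
by move: yD; rewrite in_itv/= => /andP[].
Qed.

End W21Theory.

(** * The space W23 *)

Section W23Theory.
Variables (R : realType) (a T : R).
Hypothesis aT : a < T.
Local Notation D := [set` `[a, T]].
Local Notation mu := (@lebesgue_measure R).
Local Notation "u ^'" := (derive_in D u).
Local Notation "u ^''" := (nderive_in D 2 u).
Implicit Types (c : R) (f g u v w : R -> R).

Lemma W23_linear c u v : W23 a T u -> W23 a T v ->
  W23 a T (fun x => c * u x + v x) /\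
  {in `[a, T], (fun x => c * u x + v x)^'' =1 (fun x => c * u^'' x + v^'' x)}.
Proof.
move=> [du ddu Wu ua u'a] [dv ddv Wv va v'a]; have aD := left_mem_segment aT.
have E1 : {in `[a, T], (fun x => c * u x + v x)^' =1 (fun x => c * u^' x + v^' x)}.
  by move=> x xD; apply: (derive_in_linear aT c xD _ _).2; [exact: du|exact: dv].
have E2 : {in `[a, T], (fun x => c * u x + v x)^'' =1 (fun x => c * u^'' x + v^'' x)}.
  move=> x xD; rewrite /nderive_in/= (eq_derive_in xD E1).
  by apply: (derive_in_linear aT c xD _ _).2; [exact: ddu|exact: ddv].
split; last exact: E2.
split.
- by move=> x xD; apply: (derive_in_linear aT c xD _ _).1; [exact: du|exact: dv].
- move=> x xD; apply: (@eq_derivable_in _ _ _ (fun x => c * u^' x + v^' x)) => //.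
    by move=> y yD; rewrite E1.
  by apply: (derive_in_linear aT c xD _ _).1; [exact: ddu|exact: ddv].
- apply: (@W21_ext _ _ _ (fun x => c * u^'' x + v^'' x)).
    by move=> x xD; rewrite E2.
  exact: (W21_linear aT c Wu Wv).1.
- by rewrite ua va mulr0 addr0.
- by rewrite E1// u'a v'a mulr0 addr0.
Qed.

Lemma W23_0 : W23 a T (fun=> 0).
Proof.
have aD := left_mem_segment aT.
have E0 x : x \in `[a, T] -> derivable_in D (fun=> 0) x /\ (fun=> 0)^' x = 0.
  move=> xD; apply: derive_inE => //.
  rewrite (_ : diff_quotient _ _ = fun=> 0).
    by have PF := within_itv_proper aT xD; exact: cvg_cst.
  by apply/funext => y; rewrite /diff_quotient subrr mul0r.
have E1 : {in `[a, T], (fun=> 0) =1 (fun=> 0 : R)^'} by move=> x /E0[].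
have E2 : {in `[a, T], (fun=> 0) =1 (fun=> 0 : R)^''}.
  by move=> x xD; rewrite /nderive_in/= -(eq_derive_in xD E1) (E0 x xD).2.
split.
- by move=> x /E0[].
- by move=> x xD; apply: (eq_derivable_in xD E1); exact: (E0 x xD).1.
- exact: (W21_ext E2 (W21_cst aT 0).1).
- by [].
- by rewrite -E1.
Qed.

(** The terms of order 0 and 1 vanish at [a]; what remains is the W21 product of the second
    derivatives. Positivity, Cauchy-Schwarz and completeness are transported along this isometry. *)
Lemma W23_ipE u v : W23 a T u -> W23 a T v ->
  W23_ip a T u v = W21_ip a T (u^'') (v^'').
Proof.
move=> [_ _ _ ua u'a] _; rewrite /W23_ip !big_ord_recr big_ord0/=.
by rewrite ua u'a !mul0r !add0r.
Qed.

Lemma W23_ip_ext u u' v v' : {in `[a, T], u =1 u'} -> {in `[a, T], v =1 v'} ->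
  W23_ip a T u v = W23_ip a T u' v'.
Proof.
move=> uu vv; have aD := left_mem_segment aT; rewrite /W23_ip.
apply: (@f_equal2 _ _ _ +%R).
  by apply: eq_bigr => i _; rewrite (eq_nderive_in i aD uu) (eq_nderive_in i aD vv).
apply: eq_Rintegral => x /set_mem xD.
by rewrite (eq_nderive_in 3 xD uu) (eq_nderive_in 3 xD vv).
Qed.

Lemma W23_ipC u v : W23_ip a T u v = W23_ip a T v u.
Proof.
rewrite /W23_ip; apply: (@f_equal2 _ _ _ +%R).
  by apply: eq_bigr => i _; rewrite mulrC.
exact: L2_ipC.
Qed.

Lemma W23_ip_linear c u v w : W23 a T u -> W23 a T v -> W23 a T w ->
  W23_ip a T (fun x => c * u x + v x) w = c * W23_ip a T u w + W23_ip a T v w.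
Proof.
move=> Wu Wv Ww; have [Wuv E] := W23_linear c Wu Wv.
rewrite !W23_ipE// (W21_ip_ext aT E (fun _ _ => erefl _)) W21_ip_linear//.
- by case: Wu.
- by case: Wv.
- by case: Ww.
Qed.

Lemma W23_ip_ge0 u : W23 a T u -> 0 <= W23_ip a T u u.
Proof. by move=> Wu; rewrite W23_ipE// W21_ip_ge0. Qed.

Lemma W23_rel_continuous u : W23 a T u -> rel_continuous a T u.
Proof. by move=> [du _ _ _ _] x xD; apply: derivable_in_rel_continuous => //; exact: du. Qed.

(** Surjectivity of the isometry: integrate twice from [a]. Both integrands are continuous, so the
    derivatives exist at every point. *)
Lemma W23_antiderivative2 w : W21 a T w ->
  exists2 u, W23 a T u & {in `[a, T], u^'' =1 w}.
Proof.
move=> Ww; have aD := left_mem_segment aT.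
have integrable_cont f : rel_continuous a T f -> mu.-integrable D (EFin \o f).
  move=> cf; apply: continuous_compact_integrable; first exact: segment_compact.
  exact/rel_continuousP.
have cw := W21_rel_continuous Ww.
have dw x : x \in `[a, T] -> derivable_in D (primitive a w) x /\ (primitive a w)^' x = w x.
  by move=> xD; apply: primitive_derive => //; exact: integrable_cont.
have cp : rel_continuous a T (primitive a w).
  by move=> x xD; apply: derivable_in_rel_continuous => //; exact: (dw x xD).1.
have dp x : x \in `[a, T] ->
    derivable_in D (primitive a (primitive a w)) x /\
    (primitive a (primitive a w))^' x = primitive a w x.
  by move=> xD; apply: primitive_derive => //; exact: integrable_cont.
set u := primitive a (primitive a w) in dp.
have E1 : {in `[a, T], primitive a w =1 u^'} by move=> x /dp[].
have E2 : {in `[a, T], w =1 u^''}.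
  by move=> x xD; rewrite /nderive_in/= -(eq_derive_in xD E1) (dw x xD).2.
exists u; last by move=> x xD; rewrite E2.
split.
- by move=> x /dp[].
- by move=> x xD; apply: (eq_derivable_in xD E1); exact: (dw x xD).1.
- exact: W21_ext Ww.
- by rewrite /u primitive0.
- by rewrite -E1// primitive0.
Qed.

Lemma W23B u v : W23 a T u -> W23 a T v ->
  W23 a T (fun x => u x - v x) /\
  {in `[a, T], (fun x => u x - v x)^'' =1 (fun x => u^'' x - v^'' x)}.
Proof.
move=> Wu Wv; rewrite (_ : (fun x => u x - v x) = (fun x => -1 * v x + u x)).
  have [W E] := W23_linear (-1) Wv Wu.
  by split; [exact: W|move=> x /E ->; ring].
by apply/funext => x; ring.
Qed.

Theorem W23_complete (f : nat -> R -> R) : (forall n, W23 a T (f n)) ->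
  (forall e, 0 < e -> exists N, forall m n, (N <= m)%N -> (N <= n)%N ->
     W23_ip a T (fun x => f m x - f n x) (fun x => f m x - f n x) <= e) ->
  exists2 g, W23 a T g &
    forall e, 0 < e -> exists N, forall n, (N <= n)%N ->
      W23_ip a T (fun x => f n x - g x) (fun x => f n x - g x) <= e.
Proof.
move=> Wf cf.
have WB m n := W23B (Wf m) (Wf n).
have [w Ww wP] : exists2 w, W21 a T w &
    forall e, 0 < e -> exists N, forall n, (N <= n)%N ->
      W21_ip a T (fun x => (f n)^'' x - w x) (fun x => (f n)^'' x - w x) <= e.
  apply: W21_complete => // [n|e e0]; first by case: (Wf n).
  have [N NP] := cf e e0; exists N => m n Nm Nn.
  apply: le_trans (NP m n Nm Nn).
  by rewrite (W23_ipE (WB m n).1 (WB m n).1) (W21_ip_ext aT (WB m n).2 (WB m n).2).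
have [u Wu uw] := W23_antiderivative2 Ww.
exists u => // e e0; have [N NP] := wP e e0; exists N => n Nn.
apply: le_trans (NP n Nn).
have [WBu E] := W23B (Wf n) Wu.
rewrite W23_ipE// le_eqVlt; apply/orP; left; apply/eqP.
by apply: W21_ip_ext => // x xD; rewrite E// uw.
Qed.

Lemma derivable_in_is_derive f x : x \in `]a, T[ -> derivable_in D f x ->
  is_derive x 1 f (f^' x).
Proof.
rewrite in_itv/= => /andP[ax xT] /cvg_diff_quotientP H.
have xD : x \in `[a, T] by rewrite in_itv/= !ltW.
have C : (fun h => h^-1 *: ((f \o shift x) (h *: 1) - f x)) @ (dnbhs (0 : R)) --> f^' x.
  apply/cvgrPdist_lt => e e0; have [d d0 dP] := H e e0.
  (* This radius keeps [h + x] inside the segment, where the relative quotient is controlled. *)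
  apply/nbhs_ballP; exists (Num.min d (Num.min (x - a) (T - x))) => /=.
    by rewrite !lt_min d0 !subr_gt0 ax.
  move=> h; rewrite /ball/= sub0r normrN !lt_min => /and3P[hd ha hT] h0.
  rewrite distrC [h *: 1]mulr1 [_ *: _]mulrC.
  have := dP (h + x); rewrite /diff_quotient addrK; apply => //.
  - move: ha hT; rewrite !ltr_norml in_itv/= => /andP[h1 _] /andP[_ h2].
    by apply/andP; split; lra.
  - by rewrite -subr_eq0 addrK.
by apply: DeriveDef; [exact: cvgP C|exact: cvg_lim C].
Qed.

Lemma le_norm_of_derive_in f (M : R) : (forall x, x \in `[a, T] -> derivable_in D f x) ->
  (forall x, x \in `[a, T] -> `|f^' x| <= M) -> f a = 0 ->
  forall x, x \in `[a, T] -> `|f x| <= M * (T - a).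
Proof.
move=> df f'M fa x; rewrite in_itv/= le_eqVlt => /andP[/predU1P[<- _|ax xT]].
  by rewrite fa normr0 mulr_ge0 ?subr_ge0 ?(ltW aT)// (le_trans _ (f'M a (left_mem_segment aT))).
have sub y : y \in `[a, x] -> y \in `[a, T].
  by rewrite !in_itv/= => /andP[-> yx]; exact: le_trans xT.
have dfx y : y \in `]a, x[ -> is_derive y 1 f (f^' y).
  rewrite in_itv/= => /andP[ay yx]; apply: derivable_in_is_derive.
    by rewrite in_itv/= ay (lt_le_trans yx).
  by apply: df; rewrite in_itv/= (ltW ay) (le_trans (ltW yx)).
have cf : {within [set` `[a, x]], continuous f}.
  apply/rel_continuousP => y yI e e0.
  have [d d0 dP] := derivable_in_rel_continuous (sub y yI) (df y (sub y yI)) e0.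
  by exists d => // z zI; apply: dP; exact: sub.
have [c cI E] := MVT ax dfx cf.
rewrite -[f x]subr0 -fa E normrM [`|x - a|]gtr0_norm ?subr_gt0//.
apply: ler_pM => //; [by rewrite subr_ge0 ltW| |by rewrite lerD2r].
apply/f'M/sub; move: cI; rewrite !in_itv/= => /andP[? ?].
by rewrite !ltW.
Qed.

(** The square root bounds the second derivative through the kernel of W21; each factor [T - a] is
    one use of the mean value theorem. *)
Lemma W23_sup_bound (G : R -> R -> R) : is_kernel_W21 a T G ->
  exists2 K, 0 <= K & forall u, W23 a T u -> forall x, x \in `[a, T] ->
    `|u x| <= K * W23_norm a T u.
Proof.
move=> GP; exists (Num.sqrt (1 + (T - a)) * (T - a) * (T - a)).
  by rewrite !mulr_ge0 ?sqrtr_ge0// subr_ge0 ltW.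
move=> u Wu x xD; have [du ddu W ua u'a] := Wu.
have B2 y : y \in `[a, T] -> `|u^'' y| <= Num.sqrt (1 + (T - a)) * W23_norm a T u.
  by move=> yD; have := W21_sup_bound aT GP W yD; rewrite /W21_norm /W23_norm W23_ipE.
have B1 y := le_norm_of_derive_in ddu B2 u'a (x := y).
have := le_norm_of_derive_in du B1 ua xD; congr (_ <= _); ring.
Qed.

End W23Theory.

(** * Orthonormal series, continuity of F, density *)

Section W23Sums.
#[local] Opaque W23_ip nderive_in.
Variables (R : realType) (a T : R).
Hypothesis aT : a < T.
Implicit Types (u v w : R -> R).

Lemma W23_ipBB u v : W23 a T u -> W23 a T v ->
  W23_ip a T (fun x => u x - v x) (fun x => u x - v x) =
  W23_ip a T u u - 2 * W23_ip a T u v + W23_ip a T v v.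
Proof.
move=> Wu Wv; have [WB _] := W23B aT Wu Wv.
have BE : (fun x => u x - v x) = (fun x => -1 * v x + u x).
  by apply/funext => x; ring.
have lin w : W23 a T w -> W23_ip a T (fun x => u x - v x) w = W23_ip a T u w - W23_ip a T v w.
  by move=> Ww; rewrite BE (W23_ip_linear aT (-1) Wv Wu Ww) mulN1r addrC.
rewrite (lin _ WB) (W23_ipC _ _ u) (W23_ipC _ _ v) (lin _ Wu) (lin _ Wv) (W23_ipC _ _ v u).
by move: (W23_ip a T u u) (W23_ip a T u v) (W23_ip a T v v) => p q r; ring.
Qed.

Lemma W23_CauchySchwarz u v : W23 a T u -> W23 a T v ->
  W23_ip a T u v ^+ 2 <= W23_ip a T u u * W23_ip a T v v.
Proof.
move=> Wu Wv; rewrite (W23_ipE Wu Wv) (W23_ipE Wu Wu) (W23_ipE Wv Wv).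
by have [_ _ Wu2 _ _] := Wu; have [_ _ Wv2 _ _] := Wv; exact: W21_CauchySchwarz.
Qed.

Variables (c : nat -> R) (phi : nat -> R -> R).
Hypothesis Wphi : forall i, W23 a T (phi i).

Lemma W23_sum n : W23 a T (fun y => \sum_(i < n) c i * phi i y).
Proof.
elim: n => [|n IH].
  rewrite (_ : (fun y => _) = fun=> 0); first exact: W23_0.
  by apply/funext => y; rewrite big_ord0.
rewrite (_ : (fun y => _) = (fun y => c n * phi n y + \sum_(i < n) c i * phi i y)).
  exact: (W23_linear aT (c n) (Wphi n) IH).1.
by apply/funext => y; rewrite big_ord_recr/= addrC.
Qed.

Lemma W23_ip_sum n w : W23 a T w ->
  W23_ip a T (fun y => \sum_(i < n) c i * phi i y) w =
  \sum_(i < n) c i * W23_ip a T (phi i) w.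
Proof.
move=> Ww; elim: n => [|n IH].
  have W0 := W23_0 aT.
  (* Writing zero as [-1 * 0 + 0], linearity turns its product with [w] into a quantity minus
     itself. *)
  rewrite big_ord0 (_ : (fun y => _) = fun y => -1 * (fun=> 0) y + (fun=> 0) y).
    by rewrite (W23_ip_linear aT (-1) W0 W0 Ww) mulN1r addNr.
  by apply/funext => y; rewrite big_ord0 mulr0 addr0.
rewrite (_ : (fun y => _) = (fun y => c n * phi n y + \sum_(i < n) c i * phi i y)).
  by rewrite (W23_ip_linear aT (c n) (Wphi n) (W23_sum n) Ww) IH big_ord_recr addrC.
by apply/funext => y; rewrite big_ord_recr/= addrC.
Qed.

Hypothesis phi_on : forall i j, W23_ip a T (phi i) (phi j) = (i == j)%:R.

Lemma W23_ip_orthonormal n j : (j < n)%N ->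
  W23_ip a T (fun y => \sum_(i < n) c i * phi i y) (phi j) = c j.
Proof.
move=> jn; rewrite (W23_ip_sum _ (Wphi j)) (bigD1 (Ordinal jn))//= phi_on eqxx mulr1.
rewrite big1 ?addr0// => i; rewrite -val_eqE/= phi_on => /negbTE ->.
by rewrite mulr0.
Qed.

Lemma W23_ip_partial_sums m n : (m <= n)%N ->
  W23_ip a T (fun y => \sum_(i < n) c i * phi i y)
    (fun y => \sum_(i < m) c i * phi i y) = \sum_(i < m) c i ^+ 2.
Proof.
move=> mn; rewrite W23_ipC (W23_ip_sum _ (W23_sum n)).
apply: eq_bigr => i _; have im : (i < n)%N by exact: leq_trans mn.
by rewrite W23_ipC (W23_ip_orthonormal im) expr2.
Qed.

Lemma W23_bounded_series_cauchy (M : R) :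
  (forall n, W23_norm a T (fun y => \sum_(i < n) c i * phi i y) <= M) ->
  forall e, 0 < e -> exists N, forall m n, (N <= m)%N -> (N <= n)%N ->
    W23_ip a T
      (fun x => \sum_(i < m) c i * phi i x - \sum_(i < n) c i * phi i x)
      (fun x => \sum_(i < m) c i * phi i x - \sum_(i < n) c i * phi i x) <= e.
Proof.
move=> bM e e0.
pose s n := \sum_(i < n) c i ^+ 2.
have s_nd : nondecreasing_seq s.
  apply/nondecreasing_seqP => n; rewrite /s big_ord_recr/= lerDl.
  exact: sqr_ge0.
have s_bd n : s n <= M ^+ 2.
  have := bM n; rewrite /W23_norm (W23_ip_partial_sums (leqnn n)) -/(s n) => H.
  have s0 : 0 <= s n by apply: sumr_ge0 => i _; exact: sqr_ge0.
  rewrite -(sqr_sqrtr s0).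
  by rewrite ler_sqr ?nnegrE ?sqrtr_ge0// (le_trans (sqrtr_ge0 _) H).
have : cvgn s.
  by apply: nondecreasing_is_cvgn => //; exists (M ^+ 2) => _ [n _ <-].
move=> /cvg_ex[/= l /cvgrPdist_lt/(_ (e / 2))[|N _ NP]]; first by rewrite divr_gt0.
exists N => m n Nm Nn.
(* The cross term is the shorter of the two sums of squares, so the squared distance is the
   difference of the sums. *)
have E : W23_ip a T
      (fun x => \sum_(i < m) c i * phi i x - \sum_(i < n) c i * phi i x)
      (fun x => \sum_(i < m) c i * phi i x - \sum_(i < n) c i * phi i x)
    = `|s m - s n|.
  rewrite (W23_ipBB (W23_sum m) (W23_sum n)).
  rewrite (W23_ip_partial_sums (leqnn m)) (W23_ip_partial_sums (leqnn n)).
  rewrite -/(s m) -/(s n).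
  have [mn|/ltnW nm] := leqP m n.
    rewrite W23_ipC (W23_ip_partial_sums mn) -/(s m) distrC.
    by rewrite ger0_norm ?subr_ge0 ?s_nd//; ring.
  by rewrite (W23_ip_partial_sums nm) -/(s n) ger0_norm ?subr_ge0 ?s_nd//; ring.
rewrite E [leRHS]splitr (_ : s m - s n = (l - s n) - (l - s m)); last by ring.
by apply: le_trans (ler_normB _ _) _; rewrite lerD// ltW// NP.
Qed.

End W23Sums.

(** Shrinking the displacement from the centre by a factor [t <= 1] shrinks every nonconstant term
    by at least [t]; the variation of [F] is thus at most [t] times an absolute double sum at a
    fixed reference point. *)
Lemma analytic2_continuous (R : realType) (a T : R) (F : R -> R -> R) x0 y0 :
  a < T -> analytic2_on [set` `[a, T]] F -> x0 \in `[a, T] ->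
  forall e, 0 < e -> exists2 d, 0 < d & forall x y, x \in `[a, T] ->
    `|x - x0| < d -> `|y - y0| < d -> `|F x y - F x0 y0| < e.
Proof.
move=> aT Fan xD e e0; have [r [c [r0 H]]] := Fan x0 y0 xD.
(* The expansion is only available over the segment, so the first coordinate of the reference point
   is chosen there; the second is free and is displaced by the same [rho]. *)
have [x1 [x1D x10 x1r]] := itv_near aT xD r0.
pose rho := `|x1 - x0|; have rho0 : 0 < rho by rewrite normr_gt0 subr_eq0.
pose B n := \sum_(i < n) \sum_(j < n) `|c i j| * rho ^+ i * rho ^+ j.
have [M M0 BM] : exists2 M, 0 <= M & forall n, B n <= M.
  have y1E : y0 + rho - y0 = rho by rewrite addrC addKr.
  have y1r : `|y0 + rho - y0| < r by rewrite y1E gtr0_norm.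
  have [cB _] := H x1 (y0 + rho) x1D x1r y1r.
  have BE : (fun n => \sum_(i < n) \sum_(j < n)
      `|c i j * (x1 - x0) ^+ i * (y0 + rho - y0) ^+ j|) = B.
    apply/funext => n; apply: eq_bigr => i _; apply: eq_bigr => j _.
    by rewrite !normrM !normrX y1E [`|rho|]gtr0_norm.
  rewrite BE in cB.
  have B_nd : nondecreasing_seq B.
    apply/nondecreasing_seqP => n; rewrite /B big_ord_recr/=.
    rewrite -[leLHS]addr0 lerD//.
      apply: ler_sum => i _; rewrite big_ord_recr/= lerDl.
      by rewrite !mulr_ge0// exprn_ge0// ltW.
    by apply: sumr_ge0 => j _; rewrite !mulr_ge0// exprn_ge0// ltW.
  exists (lim (B @ \oo)) => [|n]; last exact: nondecreasing_cvgn_le.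
  by have := nondecreasing_cvgn_le B_nd cB 0%N; rewrite /B big_ord0.
pose t := Num.min 1 (e / 2 / (M + 1)).
have M1 : 0 < M + 1 by rewrite ltr_wpDl.
have t0 : 0 < t by rewrite lt_min ltr01 !divr_gt0.
have t1 : t <= 1 by rewrite ge_min lexx.
have tM : t * M < e.
  apply: (@le_lt_trans _ _ (e / 2)); last by rewrite ltr_pdivrMr// ltr_pMr// ltr1n.
  apply: (@le_trans _ _ (t * (M + 1))); first by rewrite ler_pM2l// lerDl.
  by rewrite -ler_pdivlMr// ge_min lexx orbT.
exists (Num.min r (t * rho)); first by rewrite lt_min r0 mulr_gt0.
move=> x y xI; rewrite !lt_min => /andP[xr xt] /andP[yr yt].
have [_ cxy] := H x y xI xr yr.
have x0r : `|x0 - x0| < r by rewrite subrr normr0.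
have y0r : `|y0 - y0| < r by rewrite subrr normr0.
have [_ c0] := H x0 y0 xD x0r y0r.
apply: le_lt_trans tM.
apply: (@cvgr_to_le _ _ _ _ _ _ _ (cvg_norm (cvgB cxy c0))).
apply: nearW => n.
suff : `|\sum_(i < n) \sum_(j < n) c i j * (x - x0) ^+ i * (y - y0) ^+ j -
    \sum_(i < n) \sum_(j < n) c i j * (x0 - x0) ^+ i * (y0 - y0) ^+ j| <= t * M by [].
rewrite -sumrB; apply: le_trans (ler_norm_sum _ _ _) _.
apply: (@le_trans _ _ (t * B n)); last by rewrite ler_pM2l.
rewrite /B mulr_sumr; apply: ler_sum => i _.
rewrite -sumrB; apply: le_trans (ler_norm_sum _ _ _) _.
rewrite mulr_sumr; apply: ler_sum => j _.
rewrite !subrr -!mulrA -mulrBr normrM [leRHS]mulrCA ler_wpM2l//.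
(* The constant terms cancel, since both powers of exponent 0 are 1; for [i + j > 0] the term at the
   centre vanishes. *)
have [ij|ij] := posnP (i + j)%N.
  move/eqP: ij; rewrite addn_eq0 => /andP[/eqP -> /eqP ->].
  by rewrite !expr0 !mulr1 subrr normr0 ltW.
have -> : (0 : R) ^+ i * 0 ^+ j = 0 by rewrite -exprD expr0n gtn_eqF.
rewrite subr0 normrM !normrX.
apply: (@le_trans _ _ ((t * rho) ^+ i * (t * rho) ^+ j)).
  by apply: ler_pM; rewrite ?exprn_ge0//; apply: lerXn2r;
    rewrite ?nnegrE ?normr_ge0 ?mulr_ge0 ?(ltW xt) ?(ltW yt) ?(ltW t0) ?(ltW rho0).
rewrite !exprMn mulrACA -exprD ler_wpM2r ?mulr_ge0 ?exprn_ge0// ?(ltW rho0)//.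
by rewrite -[leRHS]expr1; apply: ler_wiXn2l => //; exact: ltW.
Qed.

(** By induction on [N]: if the term found in the interval has index exactly [N], a second search
    strictly to its right must return a larger index. *)
Lemma dense_seq_tail (R : realType) (a T : R) (x_ : nat -> R) :
  [set` `[a, T]] `<=` closure (range x_) ->
  forall N p q, a <= p -> p < q -> q <= T ->
  exists2 n, (N <= n)%N & p < x_ n < q.
Proof.
move=> dense; elim=> [|N IH] p q ap pq qT.
  have mD : [set` `[a, T]] ((p + q) / 2).
    by rewrite /= in_itv/=; apply/andP; split; lra.
  have [|_ [[n _ <-]]] := dense _ mD (ball ((p + q) / 2) ((q - p) / 2)).
    by apply: nbhsx_ballx; lra.
  rewrite /ball/= ltr_norml => /andP[h1 h2]; exists n => //.
  by apply/andP; split; lra.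
have [n Nn /andP[px xq]] := IH p q ap pq qT.
have [Nn'|nN] := ltnP N n; first by exists n; rewrite ?px.
have {}nN : n = N by apply/eqP; rewrite eqn_leq nN.
have [m Nm /andP[xm mq]] := IH (x_ n) q (le_trans ap (ltW px)) xq qT.
exists m; last by rewrite (lt_trans px xm).
rewrite ltn_neqAle Nm andbT; apply/eqP => Nm'.
by move: xm; rewrite nN Nm' ltxx.
Qed.

(** * The collocation method *)

Section Collocation.
Variables (R : realType) (a T k : R).
Hypothesis aT : a < T.
Variables (G : R -> R -> R) (Lstar : (R -> R) -> (R -> R)).
Hypothesis G_kernel : is_kernel_W21 a T G.
Hypothesis Lstar_adjoint : is_adjoint_L a T k Lstar.
Hypothesis L_W21 : forall u, W23 a T u -> W21 a T (Lop a T k u).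
Implicit Types u v : R -> R.

Lemma W23_psi z : z \in `[a, T] -> W23 a T (Lstar (G z)).
Proof. by move=> zD; have [WG _] := G_kernel zD; have [] := Lstar_adjoint WG. Qed.

Lemma W23_ip_psi u z : W23 a T u -> z \in `[a, T] ->
  W23_ip a T u (Lstar (G z)) = Lop a T k u z.
Proof.
move=> Wu zD; have [WG repr] := G_kernel zD.
have [_ adj] := Lstar_adjoint WG.
by rewrite -(adj _ Wu) (repr _ (L_W21 Wu)).
Qed.

Variable x_ : nat -> R.
Hypothesis x_in : forall i, x_ i \in `[a, T].
Variable beta : nat -> nat -> R.
Let psi (i : nat) : R -> R := Lstar (G (x_ i)).
Hypothesis beta_gs : gram_schmidt a T psi beta.
Let psib := psi_bar beta psi.

Lemma W23_psi_bar i : W23 a T (psib i).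
Proof. exact: (W23_sum aT (beta i) (fun j => W23_psi (x_in j)) i.+1). Qed.

(* The array [beta] is lower triangular with positive diagonal, hence injective. *)
Lemma Lop_at_nodes u (y : nat -> R) : W23 a T u ->
  (forall n, W23_ip a T u (psib n) = \sum_(j < n.+1) beta n j * y j) ->
  forall j, Lop a T k u (x_ j) = y j.
Proof.
move=> Wu uy; have [beta_gt0 _] := beta_gs.
have sum0 n : \sum_(j < n.+1) beta n j * (Lop a T k u (x_ j) - y j) = 0.
  have H := W23_ip_sum aT (beta n) (fun j => W23_psi (x_in j)) n.+1 Wu.
  have H' : W23_ip a T u (psib n) = \sum_(j < n.+1) beta n j * Lop a T k u (x_ j).
    rewrite W23_ipC; apply: etrans H _; apply: eq_bigr => j _.
    by rewrite W23_ipC W23_ip_psi.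
  rewrite (eq_bigr (fun j : 'I_n.+1 => beta n j * Lop a T k u (x_ j) - beta n j * y j)).
    by rewrite sumrB -H' -uy subrr.
  by move=> j _; rewrite mulrBr.
move=> j; apply/eqP; rewrite -subr_eq0; apply/eqP.
elim/ltn_ind: j => j IH; have := sum0 j.
rewrite big_ord_recr/= big1 ?add0r => [|i _]; last by rewrite IH ?mulr0.
by move/eqP; rewrite mulf_eq0 gt_eqF//= => /eqP.
Qed.

End Collocation.

(** * Passage to the limit in inner products, and the convergence theorem *)

Lemma le0_all_gt0 (R : realType) (x : R) : (forall e, 0 < e -> x <= e) -> x <= 0.
Proof.
move=> H; rewrite leNgt; apply/negP => x0.
have := H (x / 2) ltac:(by rewrite divr_gt0).
by rewrite leNgt ltr_pdivrMr// ltr_pMr// ltr1n.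
Qed.

(** Continuity of the inner product in its first argument, by Cauchy-Schwarz. *)
Lemma W23_ip_limit (R : realType) (a T : R) (aT : a < T) (f : nat -> R -> R)
    (g w : R -> R) (l : R) : (forall n, W23 a T (f n)) -> W23 a T g -> W23 a T w ->
  (forall e, 0 < e -> exists N, forall n, (N <= n)%N ->
     W23_ip a T (fun x => f n x - g x) (fun x => f n x - g x) <= e) ->
  (exists N, forall n, (N <= n)%N -> W23_ip a T (f n) w = l) ->
  W23_ip a T g w = l.
Proof.
move=> Wf Wg Ww fg [N fl].
pose K := W23_ip a T w w; have K0 : 0 <= K by exact: W23_ip_ge0.
have K1 : 0 < K + 1 by rewrite ltr_wpDl.
apply/eqP; rewrite eq_sym -subr_eq0 -sqrf_eq0; apply/eqP/le_anti.
rewrite sqr_ge0 andbT; apply: le0_all_gt0 => e e0.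
(* Dividing by [K + 1] rather than [K] covers a [w] of norm zero. *)
have [N' N'P] := fg (e / (K + 1)) ltac:(by rewrite divr_gt0).
have := N'P (maxn N N') (leq_maxr _ _).
set n := maxn N N' => H.
have [WB _] := W23B aT (Wf n) Wg.
have E : W23_ip a T (fun x => f n x - g x) w = l - W23_ip a T g w.
  have BE : (fun x => f n x - g x) = (fun x => -1 * g x + f n x).
    by apply/funext => x; ring.
  rewrite BE (W23_ip_linear aT (-1) Wg (Wf n) Ww) (fl n (leq_maxl _ _)).
  by rewrite mulN1r addrC.
rewrite -E; apply: le_trans (W23_CauchySchwarz aT WB Ww) _.
rewrite -/K; apply: (@le_trans _ _ (e / (K + 1) * (K + 1))); last by rewrite divfK// lt0r_neq0.
by apply: (ler_pM (W23_ip_ge0 WB) K0 H); rewrite lerDl.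
Qed.

Theorem mainTheorem2 (R : realType) (a T k : R) (aT : a < T)
    (L_bounded : L_bounded_linear a T k) (L_inj : L_injective a T k)
    (F : R -> R -> R)
    (F_analytic : analytic2_on `[a, T] F)
    (F_W21 : forall y, W23 a T y -> W21 a T (fun x => F x (y x)))
    (u : R -> R)
    (u_sol : ivp_solution a T k F u)
    (u_unique : forall v, ivp_solution a T k F v ->
       forall x, x \in `[a, T] -> v x = u x)
    (u_analytic : analytic_on `[a, T] u)
    (G : R -> R -> R) (G_kernel : is_kernel_W21 a T G)
    (Lstar : (R -> R) -> (R -> R)) (Lstar_adjoint : is_adjoint_L a T k Lstar)
    (x_ : nat -> R)
    (x_in : forall i, x_ i \in `[a, T]) (x_inj : injective x_)
    (beta : nat -> nat -> R)
    (beta_gs : gram_schmidt a T (fun i => Lstar (G (x_ i))) beta)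
    (A : nat -> R) :
  let psib := psi_bar beta (fun i => Lstar (G (x_ i))) in
  let u_ := approx_sol A psib in
  (forall n, A n = \sum_(j < n.+1) beta n j * F (x_ j) (u_ j (x_ j))) ->
  (exists M : R, forall n, W23_norm a T (u_ n) <= M) ->
  [set` `[a, T]] `<=` closure (range x_) ->
  (fun n => W23_norm a T (u_ n \- u)) @ \oo --> 0 /\
  (forall x, x \in `[a, T] -> series (fun i => A i * psib i x) @ \oo --> u x).
Proof.
move=> psib u_ AE [M bM] dense.
have [L_W21 _ _] := L_bounded.
have Wpsib i : W23 a T (psib i).
  exact: (W23_psi_bar aT G_kernel Lstar_adjoint x_in).
have [_ psib_on] := beta_gs.
have Wu_ n : W23 a T (u_ n) by exact: (W23_sum aT A Wpsib n).
have u_cauchy := W23_bounded_series_cauchy aT Wpsib psib_on bM.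
have [g Wg gP] := W23_complete aT Wu_ u_cauchy.
have g_coef n : W23_ip a T g (psib n) = A n.
  (* By orthonormality the coefficient of [u_ m] along [psib n] is already [A n] once [m > n]. *)
  apply: (W23_ip_limit aT Wu_ Wg (Wpsib n) gP); exists n.+1 => m nm.
  exact: (W23_ip_orthonormal aT A Wpsib psib_on nm).
have g_coll j : Lop a T k g (x_ j) = F (x_ j) (u_ j (x_ j)).
  (* With indices starting at 0, the iterate preceding the node of index [i] is [u_ i]. The [y i]
     enter [A n] with the same row of [beta] that defines [psib n]. *)
  pose y i := F (x_ i) (u_ i (x_ i)).
  have gy n : W23_ip a T g (psib n) = \sum_(i < n.+1) beta n i * y i.
    by rewrite g_coef AE.
  exact: (Lop_at_nodes aT G_kernel Lstar_adjoint L_W21 x_in beta_gs Wg gy j).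
have [K K0 KP] := W23_sup_bound aT G_kernel.
have norm_small e : 0 < e -> exists N, forall n, (N <= n)%N ->
    W23_norm a T (fun x => u_ n x - g x) <= e.
  move=> e0; have [N NP] := gP (e ^+ 2) ltac:(by rewrite exprn_gt0).
  exists N => n Nn; rewrite /W23_norm -[leRHS]ger0_norm ?(ltW e0)// -sqrtr_sqr.
  by rewrite ler_wsqrtr// NP.
have unif e : 0 < e -> exists N, forall n x, (N <= n)%N -> x \in `[a, T] ->
    `|u_ n x - g x| < e.
  move=> e0; have K1 : 0 < K + 1 by rewrite ltr_wpDl.
  have [N NP] := norm_small (e / (K + 1)) ltac:(by rewrite divr_gt0).
  exists N => n x Nn xD; have [WB _] := W23B aT (Wu_ n) Wg.
  apply: le_lt_trans (KP _ WB x xD) _.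
  apply: (@le_lt_trans _ _ (K * (e / (K + 1)))); first by rewrite ler_wpM2l// NP.
  by rewrite mulrCA gtr_pMr// ltr_pdivrMr// mul1r ltrDl.
have g_ode x : x \in `]a, T[ -> Lop a T k g x = F x (g x).
  rewrite in_itv/= => /andP[ax xT].
  have xD : x \in `[a, T] by rewrite in_itv/= !ltW.
  apply/eqP; rewrite -subr_eq0 -normr_le0; apply: le0_all_gt0 => e e0.
  have e20 : 0 < e / 2 by rewrite divr_gt0.
  have [d1 d10 d1P] := W21_rel_continuous (L_W21 g Wg) xD e20.
  have [d2 d20 d2P] := analytic2_continuous (g x) aT F_analytic xD e20.
  have d220 : 0 < d2 / 2 by rewrite divr_gt0.
  have [d3 d30 d3P] := W23_rel_continuous Wg xD d220.
  have [N NP] := unif _ d220.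
  pose d := Num.min d1 (Num.min d2 d3).
  have d0 : 0 < d by rewrite !lt_min d10 d20.
  (* One index must serve twice: [x_ n] has to be near [x], and [n] large enough for [u_ n] to be
     uniformly near [g]. *)
  have [n Nn /andP[xn nq]] : exists2 n, (N <= n)%N & x < x_ n < Num.min T (x + d).
    apply: (dense_seq_tail dense) => //; first exact: ltW.
      by rewrite lt_min xT ltrDl.
    by rewrite ge_min lexx.
  move: nq; rewrite lt_min => /andP[_ nd].
  have : `|x_ n - x| < d by rewrite gtr0_norm ?subr_gt0// ltrBlDl.
  rewrite !lt_min => /and3P[nd1 nd2 nd3].
  have h1 := d1P _ (x_in n) nd1.
  have h2 : `|u_ n (x_ n) - g x| < d2.
    rewrite (_ : u_ n (x_ n) - g x = (u_ n (x_ n) - g (x_ n)) + (g (x_ n) - g x)); last by ring.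
    apply: le_lt_trans (ler_normD _ _) _; rewrite [d2]splitr.
    by apply: ltrD; [exact: NP|exact: d3P].
  have h3 := d2P _ _ (x_in n) nd2 h2.
  (* The collocation identity at [x_ n] allows inserting both terms; one difference is small by
     continuity of [F], the other by continuity of L g. *)
  rewrite (_ : Lop a T k g x - F x (g x) =
    (F (x_ n) (u_ n (x_ n)) - F x (g x)) - (Lop a T k g (x_ n) - Lop a T k g x)); last first.
    by rewrite g_coll; ring.
  apply: le_trans (ler_normB _ _) _; rewrite [e]splitr.
  by apply: lerD; exact: ltW.
have gu x : x \in `[a, T] -> g x = u x.
  by apply: u_unique; have [_ _ _ ga g'a] := Wg; split.
have uE n : W23_norm a T (u_ n \- u) = W23_norm a T (fun x => u_ n x - g x).
  (* [g] and [u] are only known to agree on the segment, which is all that the norm sees. *)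
  have E : {in `[a, T], u_ n \- u =1 (fun x => u_ n x - g x)} by move=> x xD /=; rewrite gu.
  by rewrite /W23_norm (W23_ip_ext aT E E).
split.
  apply/cvgrPdist_le => e e0; have [N NP] := norm_small e e0.
  exists N => // n /= Nn; rewrite sub0r normrN uE.
  by rewrite ger0_norm ?sqrtr_ge0// NP.
move=> x xD; rewrite -gu//; apply/cvgrPdist_lt => e e0.
have [N NP] := unif e e0; exists N => // n /= Nn.
by rewrite distrC seriesEord; exact: NP.
Qed.
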